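(* Let $v\in\mathbb{C}$ with $\Re(v)>\frac12$. For every complex $s\ne1$, $$\zeta(s,v)=\frac{\left(v-\frac12\right)^{1-s}}{s-1}+i\int_0^\infty\frac{\left(v-\frac12-ix\right)^{-s}-\left(v-\frac12+ix\right)^{-s}}{e^{2\pi x}+1}\,dx$$ and $$\zeta(s,v)=\frac{\left(v-\frac12\right)^{1-s}}{s-1}-2\int_0^\infty\frac{\sin\left[s\arctan\frac{2x}{2v-1}\right]}{\left(v^2-v+\frac14+x^2\right)^{\frac{s}{2}}}\cdot\frac{dx}{e^{2\pi x}+1}.$$ Moreover, for every integer $n\ge0$, $$\gamma_n(v)=-\frac{\log^{n+1}\left(v-\frac12\right)}{n+1}+i\int_0^\infty\left\{\frac{\log^n\left(v-\frac12-ix\right)}{v-\frac12-ix}-\frac{\log^n\left(v-\frac12+ix\right)}{v-\frac12+ix}\right\}\frac{dx}{e^{2\pi x}+1}.$$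
   Context: The Hurwitz zeta function is $\zeta(s,v)=\sum_{k=0}^\infty (k+v)^{-s}$ (for $\Re(s)>1$, $v\in\mathbb{C}\setminus\{0,-1,-2,\ldots\}$), extended by analytic continuation to all complex $s\ne1$; it has a simple pole at $s=1$. The generalized Stieltjes constants $\gamma_n(v)$ are defined by the Laurent expansion $$\zeta(s,v)=\frac{1}{s-1}+\sum_{n=0}^\infty\frac{(-1)^n}{n!}\gamma_n(v)(s-1)^n,\qquad s\in\mathbb{C}\setminus\{1\}.$$ Logarithms, complex powers and $\arctan$ take their principal values, and $\log^{k} w$ means $(\log w)^k$ (with $\log^0 w=1$). *)

(* Defs.v *)
(* MathComp-Analysis, with the complex numbers R[i] of real-closed. *)
From HB Require Import structures.
From mathcomp Require Import all_boot all_order all_algebra.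
From mathcomp Require Import all_classical all_reals all_analysis.
From mathcomp Require Export complex.

Set Implicit Arguments.
Unset Strict Implicit.
Unset Printing Implicit Defensive.

Import Order.TTheory GRing.Theory Num.Theory.
Import numFieldNormedType.Exports.

Local Open Scope classical_set_scope.
Local Open Scope ring_scope.
Local Open Scope complex_scope.

Definition cmodulus (R : realType) (z : R[i]) : R :=
  Num.sqrt (complex.Re z ^+ 2 + complex.Im z ^+ 2).

Definition cexp (R : realType) (z : R[i]) : R[i] :=
  (expR (complex.Re z) * cos (complex.Im z)) +i*
  (expR (complex.Re z) * sin (complex.Im z)).

(* Principal argument: for z != 0 it takes its values in ]-pi, pi]. *)
Definition carg (R : realType) (z : R[i]) : R :=
  let theta := acos (complex.Re z / cmodulus z) in
  if 0 <= complex.Im z then theta else - theta.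

(* Principal logarithm; the value at 0 is irrelevant. *)
Definition clog (R : realType) (z : R[i]) : R[i] := ln (cmodulus z) +i* carg z.

Definition cpow (R : realType) (z s : R[i]) : R[i] := cexp (s * clog z).

Definition csin (R : realType) (z : R[i]) : R[i] :=
  (cexp ('i%C * z) - cexp (- ('i%C * z))) / (2 * 'i%C).

(* Principal branch, with cuts on the imaginary axis outside ]-i, i[. *)
Definition carctan (R : realType) (z : R[i]) : R[i] :=
  (clog (1 + 'i%C * z) - clog (1 - 'i%C * z)) / (2 * 'i%C).

(* Absolutely convergent integrals of complex functions, taken componentwise. *)
Definition cintegrable (R : realType) (D : set R) (f : R -> R[i]) : Prop :=
  lebesgue_measure.-integrable D (fun x => (complex.Re (f x))%:E) /\
  lebesgue_measure.-integrable D (fun x => (complex.Im (f x))%:E).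

Definition cintegral (R : realType) (D : set R) (f : R -> R[i]) : R[i] :=
  (\int[lebesgue_measure]_(x in D) complex.Re (f x)) +i*
  (\int[lebesgue_measure]_(x in D) complex.Im (f x)).

(* R[i]^o carries the topology of the modulus. *)
Definition cseries_to (R : realType) (u : nat -> R[i]) (l : R[i]) : Prop :=
  series (u : nat -> R[i]^o) @ \oo --> (l : R[i]^o).

Definition analytic_at (R : realType) (f : R[i] -> R[i]) (z0 : R[i]) : Prop :=
  exists2 r : R, 0 < r &
  exists a : nat -> R[i], forall z : R[i], `|z - z0| < r%:C ->
    cseries_to (fun n => a n * (z - z0) ^+ n) (f z).

(* The value at s = 1 is unconstrained; off s = 1 such a Z is unique. *)
Definition is_hurwitz_zeta (R : realType) (v : R[i]) (Z : R[i] -> R[i]) : Prop :=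
  (forall s : R[i], 1 < complex.Re s ->
     cseries_to (fun k => cpow (k%:R + v) (- s)) (Z s)) /\
  (forall s : R[i], s != 1 -> analytic_at Z s).

(* Meaningful for v outside {0, -1, -2, ...} and s != 1 only. *)
Definition hurwitz_zeta (R : realType) (s v : R[i]) : R[i] :=
  xget (fun=> 0) [set Z | is_hurwitz_zeta v Z] s.

Definition is_stieltjes (R : realType) (v : R[i]) (g : nat -> R[i]) : Prop :=
  forall s : R[i], s != 1 ->
    cseries_to (fun n => (-1) ^+ n / n`!%:R * g n * (s - 1) ^+ n)
      (hurwitz_zeta s v - 1 / (s - 1)).

Definition stieltjes (R : realType) (n : nat) (v : R[i]) : R[i] :=
  xget (fun=> 0) [set g | is_stieltjes v g] n.

(* Main.v *)
Require Import Defs.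
From HB Require Import structures.
From mathcomp Require Import all_boot all_order all_algebra.
From mathcomp Require Import all_classical all_reals all_analysis.
From mathcomp Require Import measurable_realfun lebesgue_integral_under.
From mathcomp Require Import ring lra.

Set Implicit Arguments.
Unset Strict Implicit.
Unset Printing Implicit Defensive.

Import Order.TTheory GRing.Theory Num.Theory.
Import numFieldNormedType.Exports.

Local Open Scope classical_set_scope.
Local Open Scope ring_scope.
Local Open Scope complex_scope.

Local Notation Re := complex.Re.
Local Notation Im := complex.Im.

(** Put a = v - 1/2, so that Re a > 0, and let F(a, s) be the first right-hand
side, [hurwitz_rep].  Three facts identify F with the zeta function.

The first is the difference equation F(a, s) - F(a + 1, s) = (a + 1/2)^(-s)
([hurwitz_step]).  It is the residue theorem for z^(-s) times the kernel
1 / (1 + exp (-+ 2 pi i (z - a))) on the strip between the lines Re z = Re a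
and Re z = Re a + 1: on both lines the kernel is the weight
1 / (exp (2 pi x) + 1), and the pole a + 1/2 lies on the axis of the strip.
Half a strip is treated at a time.  The mean H(x) of the integrand over the
horizontal segment at height x changes with x by the boundary integrals, which
is the theorem of Cauchy on rectangles ([rectangle_integral]), and it vanishes
at infinity ([kernel_mean_cvgy]).  Only its limit at height 0 is delicate.  For
the constant function 1 the two boundary integrals cancel, hence H = 0 at every
height ([kernel_mean_pow0]); so z^(-s) may be replaced by
z^(-s) - (a + 1/2)^(-s), and then the integrand is bounded up to the axis.
There the kernels of the two halves add up to 1, and dominated convergence
yields the integral of (a + y)^(-s) over 0 <= y <= 1, minus (a + 1/2)^(-s)
([kernel_mean_cvg0]).

Secondly, F(a + n, s) tends to 0 when Re s > 1 ([hurwitz_rep_cvg0]), so the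
difference equation telescopes to the series of (k + v)^(-s)
([hurwitz_series]).

Thirdly, F(a, s) - 1 / (s - 1) is a combination of integrals of exp (s L(x))
against integrable weights with exponential moments of every order.  Such
integrals are everywhere the sum of a power series with the moments of L as
coefficients ([exp_integral_series], [regular_pseries]).  So F is analytic off
s = 1, and the identity theorem ([identity_off_one]) shows that it is the only
continuation of the series.  The expansion at s = 1 has the stated Stieltjes
constants as coefficients, and a power series determines its coefficients
([pseries_unique]).

The form with sine and arctangent is the first form rewritten: on the right
half-plane the principal logarithm turns the products and quotients involved
into sums and differences ([sine_form]). *)

(** * The plane, the exponential and the principal logarithm *)

Arguments cexp : simpl never.
Arguments clog : simpl never.
Arguments cmodulus : simpl never.
Arguments carg : simpl never.

Section ComplexBasics.
Variable R : realType.
Implicit Types (z w u : R[i]) (x y t : R).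

Lemma complex_ext z w : Re z = Re w -> Im z = Im w -> z = w.
Proof. by case: z w => [a b] [c d] /= -> ->. Qed.

Lemma ReD z w : Re (z + w) = Re z + Re w. Proof. by case: z w => ? ? [? ?]. Qed.
Lemma ImD z w : Im (z + w) = Im z + Im w. Proof. by case: z w => ? ? [? ?]. Qed.
Lemma ReN z : Re (- z) = - Re z. Proof. by case: z. Qed.
Lemma ImN z : Im (- z) = - Im z. Proof. by case: z. Qed.
Lemma ReM z w : Re (z * w) = Re z * Re w - Im z * Im w.
Proof. by case: z w => ? ? [? ?]. Qed.
Lemma ImM z w : Im (z * w) = Re z * Im w + Im z * Re w.
Proof. by case: z w => ? ? [? ?]. Qed.
Lemma ReC x : Re x%:C = x. Proof. by []. Qed.
Lemma ImC x : Im x%:C = 0. Proof. by []. Qed.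
Lemma Re1 : Re (1 : R[i]) = 1. Proof. by []. Qed.
Lemma Im1 : Im (1 : R[i]) = 0. Proof. by []. Qed.
Lemma Re0 : Re (0 : R[i]) = 0. Proof. by []. Qed.
Lemma Im0 : Im (0 : R[i]) = 0. Proof. by []. Qed.
Lemma Rei : Re ('i%C : R[i]) = 0. Proof. by []. Qed.
Lemma Imi : Im ('i%C : R[i]) = 1. Proof. by []. Qed.
Lemma natC n : n%:R = (n%:R : R)%:C :> R[i]. Proof. by rewrite rmorph_nat. Qed.
Lemma Re_nat n : Re (n%:R : R[i]) = n%:R. Proof. by rewrite natC. Qed.
Lemma Im_nat n : Im (n%:R : R[i]) = 0. Proof. by rewrite natC. Qed.

Definition ReImE := (ReD, ImD, ReN, ImN, ReM, ImM).
(** Kept apart from the previous group: a rewrite with [ReC] unfolds [cexp], whose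
value is a literal pair. *)
Definition ReImC := (ReC, ImC, Re_nat, Im_nat, Re0, Im0, Re1, Im1, Rei, Imi).

Lemma normCE z : `|z| = (cmodulus z)%:C. Proof. by rewrite normc_def. Qed.

Lemma cmod_ge0 z : 0 <= cmodulus z. Proof. exact: sqrtr_ge0. Qed.

Lemma cmod_sqr z : cmodulus z ^+ 2 = Re z ^+ 2 + Im z ^+ 2.
Proof. by rewrite sqr_sqrtr // addr_ge0 ?sqr_ge0. Qed.

Lemma cmod0 : cmodulus (0 : R[i]) = 0.
Proof. by apply: complexI; rewrite -normCE normr0. Qed.
Lemma cmod1 : cmodulus (1 : R[i]) = 1.
Proof. by apply: complexI; rewrite -normCE normr1. Qed.
Lemma cmodi : cmodulus ('i%C : R[i]) = 1.
Proof. by rewrite /cmodulus /= expr0n /= add0r expr1n sqrtr1. Qed.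
Lemma cmodM z w : cmodulus (z * w) = cmodulus z * cmodulus w.
Proof. by apply: complexI; rewrite rmorphM /= -!normCE normrM. Qed.
Lemma cmodN z : cmodulus (- z) = cmodulus z.
Proof. by apply: complexI; rewrite -!normCE normrN. Qed.
Lemma cmodB z w : cmodulus (z - w) = cmodulus (w - z).
Proof. by rewrite -cmodN opprB. Qed.
Lemma cmodX z n : cmodulus (z ^+ n) = cmodulus z ^+ n.
Proof. by apply: complexI; rewrite rmorphXn /= -!normCE normrX. Qed.
Lemma cmodV z : cmodulus z^-1 = (cmodulus z)^-1.
Proof. by apply: complexI; rewrite fmorphV /= -!normCE normfV. Qed.
Lemma cmodR x : cmodulus x%:C = `|x|.
Proof. by rewrite /cmodulus /= expr0n /= addr0 sqrtr_sqr. Qed.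
Lemma cmod_nat n : cmodulus (n%:R : R[i]) = n%:R.
Proof. by rewrite natC cmodR normr_nat. Qed.
Lemma cmodD z w : cmodulus (z + w) <= cmodulus z + cmodulus w.
Proof. by rewrite -lecR rmorphD /= -!normCE ler_normD. Qed.
Lemma cmodBD z w : cmodulus (z - w) <= cmodulus z + cmodulus w.
Proof. by rewrite -(cmodN w) cmodD. Qed.
Lemma cmod_sub z w : cmodulus z - cmodulus w <= cmodulus (z - w).
Proof. by rewrite lerBlDr (le_trans _ (cmodD _ _)) // subrK. Qed.
Lemma cmod_eq0 z : (cmodulus z == 0) = (z == 0).
Proof.
apply/eqP/eqP => [h|->]; last exact: cmod0.
by apply/eqP; rewrite -normr_eq0 normCE h.
Qed.
Lemma cmod_gt0 z : (0 < cmodulus z) = (z != 0).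
Proof. by rewrite lt0r cmod_eq0 cmod_ge0 andbT. Qed.
Lemma cmod_sum (I : Type) (r : seq I) (P : pred I) (F : I -> R[i]) :
  cmodulus (\sum_(i <- r | P i) F i) <= \sum_(i <- r | P i) cmodulus (F i).
Proof.
elim/big_rec2: _ => [|i y z _ h]; first by rewrite cmod0.
by rewrite (le_trans (cmodD _ _)) // lerD2l.
Qed.

Lemma Re_le_cmod z : `|Re z| <= cmodulus z.
Proof. by rewrite -sqrtr_sqr ler_wsqrtr // lerDl sqr_ge0. Qed.
Lemma Im_le_cmod z : `|Im z| <= cmodulus z.
Proof. by rewrite -sqrtr_sqr ler_wsqrtr // lerDr sqr_ge0. Qed.
Lemma cmod_le z : cmodulus z <= `|Re z| + `|Im z|.
Proof.
rewrite -[leRHS]ger0_norm ?addr_ge0 // -sqrtr_sqr ler_wsqrtr //.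
rewrite sqrrD !real_normK ?num_real // -addrA lerD2l lerDr.
by rewrite mulrn_wge0 // mulr_ge0.
Qed.

Lemma Re_gt0_neq0 z : 0 < Re z -> z != 0.
Proof. by move=> h; apply: contraTneq h => ->; rewrite ltxx. Qed.

Lemma cexpE z : Re (cexp z) = expR (Re z) * cos (Im z). Proof. by []. Qed.
Lemma cexpEi z : Im (cexp z) = expR (Re z) * sin (Im z). Proof. by []. Qed.

Lemma cexpD z w : cexp (z + w) = cexp z * cexp w.
Proof.
apply: complex_ext; rewrite ?cexpE ?cexpEi !ReImE ?cexpE ?cexpEi expRD ?cosD ?sinD;
 ring.
Qed.
Lemma cexp0 : cexp (0 : R[i]) = 1.
Proof. by apply: complex_ext => /=; rewrite expR0 ?cos0 ?sin0 ?mulr1 ?mulr0. Qed.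
Lemma cmod_cexp z : cmodulus (cexp z) = expR (Re z).
Proof.
rewrite /cmodulus cexpE cexpEi !exprMn -mulrDr cos2Dsin2 mulr1 sqrtr_sqr.
by rewrite ger0_norm // expR_ge0.
Qed.
Lemma cexp_neq0 z : cexp z != 0.
Proof. by rewrite -cmod_gt0 cmod_cexp expR_gt0. Qed.
Lemma cexpN z : cexp (- z) = (cexp z)^-1.
Proof.
apply: (mulfI (cexp_neq0 z)); rewrite divff ?cexp_neq0 //.
by rewrite -cexpD subrr cexp0.
Qed.
Lemma cexpR x : cexp x%:C = (expR x)%:C.
Proof. by apply: complex_ext; rewrite /= ?cos0 ?sin0 ?mulr1 ?mulr0. Qed.

Lemma Re_clog z : Re (clog z) = ln (cmodulus z). Proof. by []. Qed.
Lemma Im_clog z : Im (clog z) = carg z. Proof. by []. Qed.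

Lemma carg_norm z : z != 0 -> -1 <= Re z / cmodulus z <= 1.
Proof.
move=> z0; have m0 : 0 < cmodulus z by rewrite cmod_gt0.
rewrite -ler_norml normrM normfV (ger0_norm (cmod_ge0 _)).
by rewrite ler_pdivrMr // mul1r Re_le_cmod.
Qed.

Lemma cos_carg z : z != 0 -> cos (carg z) = Re z / cmodulus z.
Proof.
move=> z0; have h : cos (acos (Re z / cmodulus z)) = Re z / cmodulus z.
  by apply: acosK; rewrite in_itv /= carg_norm.
by rewrite /carg; case: ifP; rewrite ?cosN.
Qed.

Lemma sin_carg z : z != 0 -> sin (carg z) = Im z / cmodulus z.
Proof.
move=> z0; have m0 : 0 < cmodulus z by rewrite cmod_gt0.
have h : sin (acos (Re z / cmodulus z)) = `|Im z| / cmodulus z.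
  rewrite sin_acos ?carg_norm //.
  have -> : 1 - (Re z / cmodulus z) ^+ 2 = (Im z / cmodulus z) ^+ 2.
    have := cmod_sqr z; have : cmodulus z != 0 by rewrite gt_eqF.
    move: (cmodulus z) => m hm e; rewrite !exprMn exprVn.
    by apply: (mulIf (expf_neq0 2 hm)); rewrite mulrBl !mulfVK ?expf_neq0 // mul1r e; ring.
  by rewrite sqrtr_sqr normrM normfV (ger0_norm (cmod_ge0 z)).
rewrite /carg; case: ifPn => [h0|]; first by rewrite h ger0_norm.
by rewrite -ltNge => h0; rewrite sinN h ltr0_norm // mulNr opprK.
Qed.

Lemma carg_pi z : z != 0 -> - pi <= carg z <= pi.
Proof.
move=> z0; have h1 := acos_ge0 (carg_norm z0); have h2 := acos_lepi (carg_norm z0).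
by rewrite /carg; case: ifP => _; apply/andP; split; lra.
Qed.

Lemma cexp_clog z : z != 0 -> cexp (clog z) = z.
Proof.
move=> z0; have m0 : 0 < cmodulus z by rewrite cmod_gt0.
by apply: complex_ext; rewrite ?cexpE ?cexpEi Re_clog Im_clog lnK ?posrE // ?cos_carg //
  ?sin_carg // mulrC mulfVK // gt_eqF.
Qed.

Lemma clog_cexp z : - pi < Im z <= pi -> clog (cexp z) = z.
Proof.
move=> /andP[h1 h2]; apply: complex_ext; rewrite ?Re_clog ?Im_clog ?cmod_cexp ?expRK //.
rewrite /carg cexpE cexpEi cmod_cexp mulrAC divff ?mul1r; last by rewrite gt_eqF ?expR_gt0.
rewrite pmulr_rge0 ?expR_gt0 //.
have [z0|z0] := leP 0 (Im z).
  rewrite sin_ge0_pi ?z0 ?h2 //; apply: cosK.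
  by rewrite in_itv /= z0.
have : sin (Im z) < 0.
  rewrite -oppr_gt0 -sinN sin_gt0_pi //; lra.
rewrite ltNge => /negbTE ->.
by rewrite cosKN ?opprK //; lra.
Qed.


Lemma carg_half z : 0 < Re z -> - (pi / 2) < carg z < pi / 2.
Proof.
move=> z0; have zN0 := Re_gt0_neq0 z0.
have m0 : 0 < cmodulus z by rewrite cmod_gt0.
suff: acos (Re z / cmodulus z) < pi / 2.
  have := acos_ge0 (carg_norm zN0); have := @pi_gt0 R.
  by rewrite /carg; case: ifP => _ ? ? ?; apply/andP; split; lra.
rewrite ltNge; apply/negP => h.
have : cos (acos (Re z / cmodulus z)) <= cos (pi / 2).
  have h1 := acos_lepi (carg_norm zN0); have h2 := acos_ge0 (carg_norm zN0).
  have h3 := @pi_gt0 R; have h4 : 0 <= (pi : R) / 2 <= pi by apply/andP; split; lra.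
  by rewrite leNgt ltr_cos ?in_itv /= -?leNgt ?h1 ?h2 ?h4.
rewrite cos_pihalf acosK ?in_itv /= ?carg_norm //.
by apply/negP; rewrite -ltNge divr_gt0.
Qed.

(** This is what makes the argument differentiable on the right half-plane. *)
Lemma carg_atan z : 0 < Re z -> carg z = atan (Im z / Re z).
Proof.
move=> z0; have zN0 := Re_gt0_neq0 z0.
have m0 : cmodulus z != 0 by rewrite cmod_eq0.
have -> : Im z / Re z = tan (carg z).
  rewrite /tan sin_carg // cos_carg // invf_div mulrA mulfVK //.
by rewrite tanK // in_itv /= carg_half.
Qed.

(** Two arguments between -pi/2 and pi/2 add up to one between -pi and pi, so the
branch is respected. *)
Lemma clogM z w : 0 < Re z -> 0 < Re w -> clog (z * w) = clog z + clog w.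
Proof.
move=> z0 w0; have := carg_half z0; have := carg_half w0 => /andP[h1 h2] /andP[h3 h4].
rewrite -{1}(cexp_clog (Re_gt0_neq0 z0)) -{1}(cexp_clog (Re_gt0_neq0 w0)) -cexpD.
by rewrite clog_cexp // ImD !Im_clog; apply/andP; split; lra.
Qed.

Lemma clog_div z w : 0 < Re z -> 0 < Re w -> clog (z / w) = clog z - clog w.
Proof.
move=> z0 w0; have := carg_half z0; have := carg_half w0 => /andP[h1 h2] /andP[h3 h4].
rewrite -{1}(cexp_clog (Re_gt0_neq0 z0)) -{1}(cexp_clog (Re_gt0_neq0 w0)) -cexpN -cexpD.
by rewrite clog_cexp // ImD ImN !Im_clog; apply/andP; split; lra.
Qed.

End ComplexBasics.

(** * Differentiable curves *)

Section Curves.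
Variable R : realType.
Implicit Types (f g : R -> R[i]) (t a b M : R) (c d e z : R[i]).

(** Holomorphic functions are differentiated only along curves, where the chain rule
reads k'(z(t)) z'(t).  The Cauchy-Riemann equations then say that the derivative
along an imaginary direction j is j times the one along the real direction. *)
Definition cderiv f t d : Prop :=
  is_derive t 1 (fun x => Re (f x)) (Re d) /\ is_derive t 1 (fun x => Im (f x)) (Im d).

Lemma cderiv_eq f t d e : cderiv f t d -> d = e -> cderiv f t e.
Proof. by move=> h <-. Qed.

Lemma cderiv_cst c t : cderiv (fun=> c) t 0.
Proof. by split; exact: is_derive_cst. Qed.

Lemma cderiv_real t : cderiv (fun x => x%:C) t 1.
Proof. by split; [exact: is_derive_id | exact: is_derive_cst]. Qed.

Lemma cderivD f g t d e :
  cderiv f t d -> cderiv g t e -> cderiv (fun x => f x + g x) t (d + e).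
Proof.
move=> [f1 f2] [g1 g2]; split.
  rewrite (_ : (fun _ => _) = (fun x => Re (f x)) + (fun x => Re (g x))); last first.
    by apply/funext => x; rewrite ReD.
  by apply: is_derive_eq; rewrite ReD.
rewrite (_ : (fun _ => _) = (fun x => Im (f x)) + (fun x => Im (g x))); last first.
  by apply/funext => x; rewrite ImD.
by apply: is_derive_eq; rewrite ImD.
Qed.

Lemma cderivM f g t d e :
  cderiv f t d -> cderiv g t e -> cderiv (fun x => f x * g x) t (d * g t + f t * e).
Proof.
move=> [f1 f2] [g1 g2]; split.
  rewrite (_ : (fun _ => _) = (fun x => Re (f x)) * (fun x => Re (g x)) -
     (fun x => Im (f x)) * (fun x => Im (g x))); last first.
    by apply/funext => x; rewrite ReM.
  by apply: (is_derive_eq (is_deriveB (is_deriveM f1 g1) (is_deriveM f2 g2)));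
    rewrite !ReImE /GRing.scale /=; ring.
rewrite (_ : (fun _ => _) = (fun x => Re (f x)) * (fun x => Im (g x)) +
   (fun x => Im (f x)) * (fun x => Re (g x))); last first.
  by apply/funext => x; rewrite ImM.
by apply: (is_derive_eq (is_deriveD (is_deriveM f1 g2) (is_deriveM f2 g1)));
  rewrite !ReImE /GRing.scale /=; ring.
Qed.

Lemma cderivN f t d : cderiv f t d -> cderiv (fun x => - f x) t (- d).
Proof.
move=> h; have := cderivM (cderiv_cst (-1) t) h.
rewrite mul0r add0r mulN1r => {}h.
by rewrite (_ : (fun _ => _) = (fun x => -1 * f x)) //; apply/funext => x; rewrite mulN1r.
Qed.

Lemma cderivB f g t d e :
  cderiv f t d -> cderiv g t e -> cderiv (fun x => f x - g x) t (d - e).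
Proof. by move=> h /cderivN; exact: cderivD. Qed.

Lemma cderivZ c f t d : cderiv f t d -> cderiv (fun x => c * f x) t (c * d).
Proof.
move=> h; apply: cderiv_eq; first exact: (cderivM (cderiv_cst c t) h).
by rewrite mul0r add0r.
Qed.

Lemma cderiv_sum n (F : nat -> R -> R[i]) (d : nat -> R[i]) t :
  (forall k, cderiv (F k) t (d k)) ->
  cderiv (fun x => \sum_(k < n) F k x) t (\sum_(k < n) d k).
Proof.
move=> h; elim: n => [|n IH].
  rewrite big_ord0 (_ : (fun _ => _) = fun=> 0); first exact: cderiv_cst.
  by apply/funext => x; rewrite big_ord0.
rewrite big_ord_recr /= (_ : (fun _ => _) = fun x => \sum_(k < n) F k x + F n x).
  exact: cderivD.
by apply/funext => x; rewrite big_ord_recr.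
Qed.

Lemma cderivX f t d n : cderiv f t d ->
  cderiv (fun x => f x ^+ n) t (n%:R * f t ^+ n.-1 * d).
Proof.
move=> h; elim: n => [|n IH].
  by rewrite !mul0r; apply: cderiv_cst.
rewrite (_ : (fun _ => _) = fun x => f x * f x ^+ n); last first.
  by apply/funext => x; rewrite exprS.
apply: cderiv_eq; first exact: cderivM h IH.
case: n {IH} => [|n]; first by rewrite /= expr0; ring.
by rewrite /= exprS -[n.+2]addn1 natrD; ring.
Qed.

(** True at 0 as well, where both sides are 0. *)
Lemma cinvE z :
  (Re z^-1 = Re z / (Re z ^+ 2 + Im z ^+ 2)) /\
  (Im z^-1 = - Im z / (Re z ^+ 2 + Im z ^+ 2)).
Proof.
by case: z => x y; rewrite /= mulNr.
Qed.

Lemma sqr_modulus_deriv f t d : cderiv f t d ->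
  is_derive t 1 (fun x => Re (f x) ^+ 2 + Im (f x) ^+ 2)
    (2 * (Re (f t) * Re d + Im (f t) * Im d)).
Proof.
move=> [f1 f2]; have h := is_deriveD (is_deriveX 2 f1) (is_deriveX 2 f2).
by apply: (is_derive_eq h); rewrite /GRing.scale /=; ring.
Qed.

Lemma cderivV f t d : f t != 0 -> cderiv f t d ->
  cderiv (fun x => (f x)^-1) t (- d / f t ^+ 2).
Proof.
move=> f0 fd; have [f1 f2] := fd.
have n0 : Re (f t) ^+ 2 + Im (f t) ^+ 2 != 0 by rewrite -cmod_sqr expf_neq0 // cmod_eq0.
pose n x := Re (f x) ^+ 2 + Im (f x) ^+ 2.
have n1 : is_derive t 1 n (2 * (Re (f t) * Re d + Im (f t) * Im d)).
  exact: sqr_modulus_deriv.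
have nt : n t = Re (f t) ^+ 2 + Im (f t) ^+ 2 by [].
have n2 : is_derive t 1 (fun x => (n x)^-1)
   (- (n t) ^- 2 * (2 * (Re (f t) * Re d + Im (f t) * Im d))).
  exact: (@is_deriveV R n t _ 1 n0 n1).
have dE : - d / f t ^+ 2 = - d * ((f t)^-1 * (f t)^-1).
  by rewrite -invfM expr2.
have [r1 r2] := cinvE (f t).
split.
  rewrite (_ : (fun _ => _) = (fun x => Re (f x)) * (fun x => (n x)^-1)); last first.
    by apply/funext => x; have [-> _] := cinvE (f x).
  apply: is_derive_eq; rewrite dE !ReImE r1 r2 /GRing.scale /= nt.
  by field.
rewrite (_ : (fun _ => _) = (- (fun x => Im (f x))) * (fun x => (n x)^-1)); last first.
  by apply/funext => x; have [_ ->] := cinvE (f x).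
apply: is_derive_eq; rewrite dE !ReImE r1 r2 /GRing.scale /= nt !fctE.
by field.
Qed.

Lemma cderiv_exp f t d : cderiv f t d ->
  cderiv (fun x => cexp (f x)) t (d * cexp (f t)).
Proof.
move=> [f1 f2].
have e1 : is_derive t 1 (fun x => expR (Re (f x))) (expR (Re (f t)) * Re d).
  by apply: (@is_derive1_comp R expR).
have e2 : is_derive t 1 (fun x => cos (Im (f x))) (- sin (Im (f t)) * Im d).
  by apply: (@is_derive1_comp R cos).
have e3 : is_derive t 1 (fun x => sin (Im (f x))) (cos (Im (f t)) * Im d).
  by apply: (@is_derive1_comp R sin).
split.
  rewrite (_ : (fun _ => _) = (fun x => expR (Re (f x))) * (fun x => cos (Im (f x)))); last first.
    by apply/funext => x; rewrite cexpE.
  by apply: is_derive_eq; rewrite !ReImE cexpE cexpEi /GRing.scale /=; ring.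
rewrite (_ : (fun _ => _) = (fun x => expR (Re (f x))) * (fun x => sin (Im (f x)))); last first.
  by apply/funext => x; rewrite cexpEi.
by apply: is_derive_eq; rewrite !ReImE cexpE cexpEi /GRing.scale /=; ring.
Qed.

End Curves.

Section CurveCalculus.
Variable R : realType.
Implicit Types (f g : R -> R[i]) (t a b M : R) (c d e z : R[i]).
Local Notation mu := (@lebesgue_measure R).

Lemma cderiv_continuous f t d : cderiv f t d ->
  {for t, continuous (fun x => Re (f x))} /\ {for t, continuous (fun x => Im (f x))}.
Proof.
move=> [[h1 _] [h2 _]].
by split; apply: differentiable_continuous; [move/derivable1_diffP: h1 | move/derivable1_diffP: h2].
Qed.

(** Near t the components are half the logarithm of the squared modulus and an
arctangent. *)
Lemma cderiv_log f t d : 0 < Re (f t) -> cderiv f t d ->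
  cderiv (fun x => clog (f x)) t (d / f t).
Proof.
move=> f0 fd; have [f1 f2] := fd; have [c1 _] := cderiv_continuous fd.
have nz : Re (f t) != 0 by rewrite gt_eqF.
pose n x := Re (f x) ^+ 2 + Im (f x) ^+ 2.
have nt : n t = Re (f t) ^+ 2 + Im (f t) ^+ 2 by [].
have n0 : 0 < n t by rewrite nt ltr_pwDl ?exprn_gt0 ?sqr_ge0.
have [r1 r2] := cinvE (f t).
have n1 : is_derive t 1 n (2 * (Re (f t) * Re d + Im (f t) * Im d)).
  exact: sqr_modulus_deriv.
have near0 : \forall x \near t, 0 < Re (f x).
  exact: (cvgr_gt (Re (f t)) c1).
split.
  apply: (@near_eq_is_derive _ _ _ (fun x => 2^-1 * ln (n x))).
    near=> x; have x0 : 0 < Re (f x) by near: x.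
    have p0 : 0 < cmodulus (f x) by rewrite cmod_gt0 Re_gt0_neq0.
    have -> : n x = cmodulus (f x) ^+ 2 by rewrite cmod_sqr.
    by rewrite lnXn // Re_clog mulr2n; field.
  have l1 : is_derive t 1 (fun x => ln (n x)) ((n t)^-1 * (2 * (Re (f t) * Re d + Im (f t) * Im d))).
    by apply: (@is_derive1_comp R (@ln R)); exact: is_derive1_ln.
  have l2 := is_deriveM (is_derive_cst (2^-1 : R) t 1) l1.
  apply: (is_derive_eq l2).
  rewrite !ReImE r1 r2 /GRing.scale /= ?fctE -nt.
  by field; rewrite gt_eqF.
apply: (@near_eq_is_derive _ _ _ (fun x => atan (Im (f x) / Re (f x)))).
  near=> x; have x0 : 0 < Re (f x) by near: x.
  by rewrite Im_clog carg_atan.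
have i1 : is_derive t 1 (fun x => (Re (f x))^-1) (- (Re (f t)) ^- 2 *: Re d).
  exact: is_deriveV.
have i2 : is_derive t 1 ((fun x => Im (f x)) * (fun x => (Re (f x))^-1))
   (Im (f t) *: (- (Re (f t)) ^- 2 *: Re d) + (Re (f t))^-1 *: Im d).
  exact: is_deriveM.
have l1 := @is_derive1_comp R (@atan R) _ t _ _ (is_derive1_atan _) i2.
change (is_derive t 1 (@atan R \o ((fun x => Im (f x)) * (fun x => (Re (f x))^-1))) (Im (d / f t))).
apply: (is_derive_eq l1).
rewrite !ReImE r1 r2 /GRing.scale /= ?fctE -nt nt.
field; rewrite nz -nt gt_eqF //= gt_eqF // ltr_pwDl ?exprn_gt0 ?sqr_ge0 //.
Unshelve. all: by end_near. Qed.

Lemma cderiv_pow f t d c : 0 < Re (f t) -> cderiv f t d ->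
  cderiv (fun x => cpow (f x) c) t (c * d * cpow (f t) c / f t).
Proof.
move=> f0 h; apply: cderiv_eq.
  exact: (cderiv_exp (cderivZ c (cderiv_log f0 h))).
by rewrite /cpow; ring.
Qed.

Lemma cderiv_within (D : set R) f : (forall t, D t -> exists d, cderiv f t d) ->
  {within D, continuous (fun x => Re (f x))} /\ {within D, continuous (fun x => Im (f x))}.
Proof.
move=> h; split; apply: continuous_in_subspaceT => t /set_mem /h [d];
  by case/cderiv_continuous.
Qed.

(** The mean value theorem gives one intermediate point for each component, hence the
factor 2. *)
Lemma mean_value a b M f (d : R -> R[i]) : a < b ->
  (forall t, a <= t <= b -> cderiv f t (d t)) ->
  (forall t, a <= t <= b -> cmodulus (d t) <= M) ->
  cmodulus (f b - f a) <= 2 * M * (b - a).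
Proof.
move=> ab fd dM.
have M0 : 0 <= M by apply: le_trans (cmod_ge0 _) (dM a _); rewrite lexx ltW.
have ba : 0 <= b - a by rewrite subr_ge0 ltW.
have [w1 w2] : {within `[a, b], continuous (fun x => Re (f x))} /\
    {within `[a, b], continuous (fun x => Im (f x))}.
  by apply: cderiv_within => t /=; rewrite in_itv /= => /fd ?; exists (d t).
have hoo t : t \in `]a, b[ -> a <= t <= b.
  by rewrite in_itv /= => /andP[? ?]; rewrite !ltW.
have [c1 /hoo h1 e1] := MVT ab (fun t ht => (fd t (hoo t ht)).1) w1.
have [c2 /hoo h2 e2] := MVT ab (fun t ht => (fd t (hoo t ht)).2) w2.
apply: le_trans (cmod_le _) _.
rewrite !ReImE e1 e2 !normrM (ger0_norm ba) -mulrDl ler_wpM2r //.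
rewrite mulr_natl mulr2n lerD //.
  exact: le_trans (Re_le_cmod _) (dM _ h1).
exact: le_trans (Im_le_cmod _) (dM _ h2).
Qed.

Lemma segment_integrable a b f :
  (forall t, a <= t <= b -> exists d, cderiv f t d) -> cintegrable `[a, b] f.
Proof.
move=> fd; have [w1 w2] : {within `[a, b], continuous (fun x => Re (f x))} /\
    {within `[a, b], continuous (fun x => Im (f x))}.
  by apply: cderiv_within => t /=; rewrite in_itv /= => /fd.
by split; apply: continuous_compact_integrable => //; exact: segment_compact.
Qed.

Lemma segment_cst_integrable a b M : mu.-integrable `[a, b] (EFin \o (fun _ : R => M)).
Proof.
apply: continuous_compact_integrable; first exact: segment_compact.
by apply: continuous_subspaceT => t; exact: cvg_cst.
Qed.

Lemma cFTC a b f F : a < b ->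
  (forall t, a <= t <= b -> cderiv F t (f t)) ->
  (forall t, a <= t <= b -> exists d, cderiv f t d) ->
  cintegrable `[a, b] f /\ cintegral `[a, b] f = F b - F a.
Proof.
move=> ab Fd fd.
have [w1 w2] : {within `[a, b], continuous (fun x => Re (f x))} /\
    {within `[a, b], continuous (fun x => Im (f x))}.
  by apply: cderiv_within => t /=; rewrite in_itv /= => /fd.
split; first exact: segment_integrable.
have hoo t : t \in `]a, b[ -> a <= t <= b.
  by rewrite in_itv /= => /andP[? ?]; rewrite !ltW.
have la : a <= a <= b by rewrite lexx ltW.
have lb : a <= b <= b by rewrite lexx ltW.
have rF (G h : R -> R) : (forall t, a <= t <= b -> is_derive t 1 G (h t)) ->
    {within `[a, b], continuous h} -> \int[mu]_(x in `[a, b]) h x = G b - G a.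
  move=> Gd wh; rewrite /Rintegral (continuous_FTC2 ab wh (F := G)) //.
    have cG t : a <= t <= b -> {for t, continuous G}.
      by move=> /Gd [h1 _]; apply/differentiable_continuous/derivable1_diffP.
    split; first by move=> t /hoo /Gd[].
      by apply: cvg_at_right_filter; exact: cG.
    by apply: cvg_at_left_filter; exact: cG.
  by move=> t /hoo /Gd [_ <-]; rewrite derive1E.
apply: complex_ext; rewrite !ReImE.
  exact: (rF (fun t => Re (F t)) (fun t => Re (f t)) (fun t ht => (Fd t ht).1) w1).
exact: (rF (fun t => Im (F t)) (fun t => Im (f t)) (fun t ht => (Fd t ht).2) w2).
Qed.

Definition cmeasurable (D : set R) f : Prop :=
  measurable_fun D (fun x => Re (f x)) /\ measurable_fun D (fun x => Im (f x)).

Lemma cderiv_measurable (D : set R) f : measurable D ->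
  (forall t, D t -> exists d, cderiv f t d) -> cmeasurable D f.
Proof.
move=> mD /cderiv_within[h1 h2].
by split; apply: subspace_continuous_measurable_fun.
Qed.
End CurveCalculus.

(** * Convergence and integration componentwise *)

Section Convergence.
Variable R : realType.
Implicit Types (u w : nat -> R[i]) (l m : R[i]).

(** Componentwise, so that limits and integrals reduce to pairs of real ones. *)
Definition ccvg u l : Prop :=
  (fun n => Re (u n)) @ \oo --> Re l /\ (fun n => Im (u n)) @ \oo --> Im l.

Lemma ccvgP u l : ccvg u l <->
  forall e : R, 0 < e -> exists N, forall n, (N <= n)%N -> cmodulus (u n - l) < e.
Proof.
split.
  move=> [/cvgrPdist_lt h1 /cvgrPdist_lt h2] e e0.
  have e2 : 0 < e / 2 by lra.
  have [N1 _ h1'] := h1 _ e2; have [N2 _ h2'] := h2 _ e2.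
  exists (maxn N1 N2) => n; rewrite geq_max => /andP[n1 n2].
  apply: le_lt_trans (cmod_le _) _.
  have /= a1 := h1' n n1; have /= a2 := h2' n n2.
  rewrite !ReImE (distrC (Re _)) (distrC (Im _)).
  lra.
move=> h; split; apply/cvgrPdist_lt => e /h[N hN]; exists N => // n /= /hN;
  apply: le_lt_trans; rewrite distrC.
  by rewrite -ReN -ReD Re_le_cmod.
by rewrite -ImN -ImD Im_le_cmod.
Qed.

Lemma cseries_toP u l : cseries_to u l <-> ccvg (fun N => \sum_(k < N) u k) l.
Proof.
rewrite ccvgP /cseries_to; split.
  move=> /cvgrPdist_lt h e e0.
  have ec : (0 : R[i]) < e%:C by rewrite -[0]/((0:R)%:C) ltcR.
  have [N _ hN] := h _ ec; exists N => n /hN /=.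
  by rewrite /series /= normCE ltcR big_mkord cmodB.
move=> h; apply/cvgrPdist_lt => e e0.
have e1 : e = (Re e)%:C.
  by apply: complex_ext => //=; move: e0; rewrite ltcE /= => /andP[/eqP].
have [|N hN] := h (Re e); first by move: e0; rewrite e1 -[0]/((0:R)%:C) ltcR.
exists N => // n /= /hN; rewrite /series /= normCE e1 ltcR big_mkord cmodB.
by rewrite ReC.
Qed.

Lemma ccvg_unique u l m : ccvg u l -> ccvg u m -> l = m.
Proof.
move=> [h1 h2] [h3 h4].
by apply: complex_ext; [apply: cvg_unique h1 h3 | apply: cvg_unique h2 h4].
Qed.

Lemma ccvgD u w l m : ccvg u l -> ccvg w m -> ccvg (fun n => u n + w n) (l + m).
Proof.
move=> [h1 h2] [h3 h4]; split; rewrite ?ReD ?ImD.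
  by under eq_fun do rewrite ReD; exact: cvgD.
by under eq_fun do rewrite ImD; exact: cvgD.
Qed.

Lemma ccvgZ l u m : ccvg u m -> ccvg (fun n => l * u n) (l * m).
Proof.
move=> [h1 h2]; split; rewrite ?ReM ?ImM.
  under eq_fun do rewrite ReM.
  by apply: cvgB; apply: cvgM => //; exact: cvg_cst.
under eq_fun do rewrite ImM.
by apply: cvgD; apply: cvgM => //; exact: cvg_cst.
Qed.

Lemma ccvg_cst l : ccvg (fun=> l) l.
Proof. by split; exact: cvg_cst. Qed.

Lemma ccvg0P u : (exists2 b : nat -> R, (forall n, cmodulus (u n) <= b n) & b @ \oo --> (0:R)) ->
  ccvg u 0.
Proof.
move=> [b ub b0]; apply/ccvgP => e e0; move/cvgrPdist_lt : b0 => /(_ _ e0)[N _ hN].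
exists N => n /hN /=; rewrite subr0 sub0r normrN; apply: le_lt_trans.
by apply: le_trans (ub n) _; exact: ler_norm.
Qed.

Lemma ccvg_eq u w l : (forall n, u n = w n) -> ccvg u l -> ccvg w l.
Proof. by move=> e; have -> : w = u by apply/funext. Qed.

Lemma cvg_ccvg (f : R -> R[i]) (d : R[i]) (t : R) (v : nat -> R) : cderiv f t d ->
  v @ \oo --> t -> ccvg (fun n => f (v n)) (f t).
Proof.
move=> /cderiv_continuous [h1 h2] vt; split.
  exact: (continuous_cvg _ h1 vt).
exact: (continuous_cvg _ h2 vt).
Qed.

End Convergence.

Section ComplexIntegral.
Variable R : realType.
Local Notation mu := (@lebesgue_measure R).
Variables (D : set R) (mD : measurable D).
Implicit Types (f g : R -> R[i]) (G : R -> R) (c : R[i]).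

Lemma Rdominated (u : nat -> R -> R) (l G : R -> R) :
  (forall n, measurable_fun D (u n)) ->
  (forall x, D x -> (fun n => u n x) @ \oo --> l x) ->
  mu.-integrable D (EFin \o G) ->
  (forall n x, D x -> `|u n x| <= G x) ->
  (fun n => \int[mu]_(x in D) u n x) @ \oo --> \int[mu]_(x in D) l x.
Proof.
move=> mu_ ul iG uG; rewrite /Rintegral; apply: fine_cvg.
have m_ n : measurable_fun D (fun x => (u n x)%:E) by exact/measurable_EFinP.
have l_ x : D x -> (fun n => (u n x)%:E) @ \oo --> (l x)%:E.
  by move=> Dx; apply: cvg_EFin; [exact: nearW | exact: ul].
have [] := @dominated_convergence _ _ _ mu D mD (fun n x => (u n x)%:E)
  (EFin \o l) (EFin \o G) m_ (emeasurable_fun_cvg _ _ m_ l_).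
- exact: aeW.
- exact: iG.
- by apply: aeW => x n Dx; rewrite lee_fin uG.
by move=> il _ h; rewrite fineK //; exact: integrable_fin_num.
Qed.

Lemma cintegrable_le f G : cmeasurable D f -> mu.-integrable D (EFin \o G) ->
  (forall x, D x -> cmodulus (f x) <= G x) -> cintegrable D f.
Proof.
move=> [m1 m2] iG fG; split; apply: le_integrable iG => //.
- exact/measurable_EFinP.
- move=> x Dx /=; rewrite lee_fin (le_trans (Re_le_cmod _)) //.
  by rewrite (le_trans (fG _ Dx)) // ler_norm.
- exact/measurable_EFinP.
- move=> x Dx /=; rewrite lee_fin (le_trans (Im_le_cmod _)) //.
  by rewrite (le_trans (fG _ Dx)) // ler_norm.
Qed.

Lemma eq_cintegrable f g : (forall x, D x -> f x = g x) -> cintegrable D f -> cintegrable D g.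
Proof.
move=> fg [h1 h2]; split.
  by apply: eq_integrable h1 => // x /set_mem Dx; rewrite fg.
by apply: eq_integrable h2 => // x /set_mem Dx; rewrite fg.
Qed.

Lemma eq_cintegral f g : (forall x, D x -> f x = g x) -> cintegral D f = cintegral D g.
Proof.
by move=> fg; rewrite /cintegral; congr Complex; apply: eq_Rintegral => x /set_mem Dx; rewrite fg.
Qed.

Lemma cintegrableD f g : cintegrable D f -> cintegrable D g ->
  cintegrable D (fun x => f x + g x).
Proof.
move=> [f1 f2] [g1 g2]; split.
  by under eq_fun do rewrite ReD EFinD; exact: integrableD.
by under eq_fun do rewrite ImD EFinD; exact: integrableD.
Qed.

Lemma cintegralD f g : cintegrable D f -> cintegrable D g ->
  cintegral D (fun x => f x + g x) = cintegral D f + cintegral D g.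
Proof.
move=> [f1 f2] [g1 g2]; apply: complex_ext; rewrite !ReImE /=.
  by under eq_Rintegral do rewrite ReD; rewrite RintegralD.
by under eq_Rintegral do rewrite ImD; rewrite RintegralD.
Qed.

Lemma integrableZ (k : R) (h : R -> R) : mu.-integrable D (EFin \o h) ->
  mu.-integrable D (EFin \o (fun x => k * h x)).
Proof.
by move=> ih; rewrite (_ : EFin \o _ = fun x => (k%:E * (EFin \o h) x)%E) //; exact: integrableZl.
Qed.

Lemma cintegrableZ c f : cintegrable D f -> cintegrable D (fun x => c * f x).
Proof.
move=> [f1 f2]; split.
  under eq_fun do rewrite ReM EFinB.
  by apply: integrableB => //; exact: integrableZ.
under eq_fun do rewrite ImM EFinD.
by apply: integrableD => //; exact: integrableZ.
Qed.

Lemma cintegralZ c f : cintegrable D f ->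
  cintegral D (fun x => c * f x) = c * cintegral D f.
Proof.
move=> [f1 f2]; apply: complex_ext; rewrite !ReImE /=.
  under eq_Rintegral do rewrite ReM.
  by rewrite RintegralB ?RintegralZl //; exact: integrableZ.
under eq_Rintegral do rewrite ImM.
by rewrite RintegralD ?RintegralZl //; exact: integrableZ.
Qed.

Lemma cintegrableB f g : cintegrable D f -> cintegrable D g ->
  cintegrable D (fun x => f x - g x).
Proof.
move=> hf /(cintegrableZ (-1)) hg; apply: eq_cintegrable (cintegrableD hf hg).
by move=> x _; rewrite mulN1r.
Qed.

Lemma cintegralB f g : cintegrable D f -> cintegrable D g ->
  cintegral D (fun x => f x - g x) = cintegral D f - cintegral D g.
Proof.
move=> hf hg; rewrite -[X in _ = _ + X]mulN1r -cintegralZ // -cintegralD //.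
  by apply: eq_cintegral => x _; rewrite mulN1r.
exact: cintegrableZ.
Qed.

Lemma cintegrable0 : cintegrable D (fun=> 0 : R[i]).
Proof. by split; exact: integrable0. Qed.

Lemma cintegral0 : cintegral D (fun=> 0 : R[i]) = 0.
Proof. by apply: complex_ext; rewrite /= Rintegral_cst // mul0r. Qed.

Lemma cintegral_sum n (F : nat -> R -> R[i]) : (forall k, cintegrable D (F k)) ->
  cintegrable D (fun x => \sum_(k < n) F k x) /\
  cintegral D (fun x => \sum_(k < n) F k x) = \sum_(k < n) cintegral D (F k).
Proof.
move=> iF; elim: n => [|n [IH1 IH2]].
  split.
    by apply: eq_cintegrable cintegrable0 => x _; rewrite big_ord0.
  rewrite big_ord0 -[RHS]cintegral0.
  by apply: eq_cintegral => x _; rewrite big_ord0.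
split.
  apply: eq_cintegrable (cintegrableD IH1 (iF n)).
  by move=> x _; rewrite big_ord_recr.
rewrite big_ord_recr /= -IH2 -cintegralD //.
by apply: eq_cintegral => x _; rewrite big_ord_recr.
Qed.

(** The factor 2 comes from bounding the two components separately. *)
Lemma cmod_cintegral f G : cintegrable D f -> mu.-integrable D (EFin \o G) ->
  (forall x, D x -> cmodulus (f x) <= G x) ->
  cmodulus (cintegral D f) <= 2 * \int[mu]_(x in D) G x.
Proof.
move=> [f1 f2] iG fG; apply: le_trans (cmod_le _) _; rewrite mulr_natl mulr2n.
have key (h : R -> R) : mu.-integrable D (EFin \o h) -> (forall x, D x -> `|h x| <= G x) ->
    `|\int[mu]_(x in D) h x| <= \int[mu]_(x in D) G x.
  move=> ih hG; apply: le_trans (@le_normr_Rintegral _ _ _ mu D h _ ih) _ => //.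
  by apply: le_Rintegral => //; exact: integrable_norm.
apply: lerD; apply: key => // x Dx.
  exact: le_trans (Re_le_cmod _) (fG x Dx).
exact: le_trans (Im_le_cmod _) (fG x Dx).
Qed.

Lemma cdominated (u : nat -> R -> R[i]) (l : R -> R[i]) G :
  (forall n, cmeasurable D (u n)) ->
  (forall x, D x -> ccvg (fun n => u n x) (l x)) ->
  mu.-integrable D (EFin \o G) ->
  (forall n x, D x -> cmodulus (u n x) <= G x) ->
  ccvg (fun n => cintegral D (u n)) (cintegral D l).
Proof.
move=> um ul iG uG; split; apply: (Rdominated (G := G)) => //.
- by move=> n; have [] := um n.
- by move=> x /ul[].
- by move=> n x Dx; exact: le_trans (Re_le_cmod _) (uG n x Dx).
- by move=> n; have [] := um n.
- by move=> x /ul[].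
- by move=> n x Dx; exact: le_trans (Im_le_cmod _) (uG n x Dx).
Qed.

End ComplexIntegral.

(** * The exponential series *)

Section ExpSeries.
Variable R : realType.
Implicit Types (z s : R[i]) (x : R).

Definition exp_sum n z : R[i] := \sum_(k < n) z ^+ k / k`!%:R.

Lemma exp_sum_real x n : 0 <= x -> \sum_(k < n) x ^+ k / k`!%:R <= expR x.
Proof.
move=> x0; have := @nondecreasing_cvgn_le R (series (exp_coeff x)).
move=> /(_ _ (is_cvg_series_exp_coeff x) n); rewrite /series /= big_mkord; apply.
apply/nondecreasing_seqP => k; rewrite /series /= big_nat_recr //= lerDl.
by rewrite divr_ge0 ?exprn_ge0.
Qed.

Lemma cmod_fact z k : cmodulus (z ^+ k / k`!%:R) = cmodulus z ^+ k / k`!%:R.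
Proof. by rewrite cmodM cmodV cmodX cmod_nat. Qed.

Lemma cmod_exp_sum z n : cmodulus (exp_sum n z) <= expR (cmodulus z).
Proof.
apply: le_trans (cmod_sum _ _ _) _.
under eq_bigr do rewrite cmod_fact.
by apply: exp_sum_real; exact: cmod_ge0.
Qed.

Lemma fact_neq0 k : k`!%:R != 0 :> R[i].
Proof. by rewrite pnatr_eq0 -lt0n fact_gt0. Qed.

Lemma exp_sum_deriv n z (t : R) :
  cderiv (fun t : R => exp_sum n.+1 (t%:C * z)) t (z * exp_sum n (t%:C * z)).
Proof.
apply: cderiv_eq.
  apply: (@cderiv_sum R n.+1 (fun k (t : R) => (t%:C * z) ^+ k / k`!%:R)) => k.
  apply: cderivM; last exact: cderiv_cst.
  by apply: cderivX; apply: cderivM; [exact: cderiv_real | exact: cderiv_cst].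
rewrite big_ord_recl /= !mul0r mulr0 !add0r mulr_sumr.
apply: eq_bigr => k _; rewrite /bump leq0n add1n add0n.
rewrite factS natrM; field; rewrite fact_neq0 /=.
by rewrite -(natrD _ 1) pnatr_eq0.
Qed.

(** Let S be the Taylor polynomial of the exponential.  The curve
t |-> exp (- t z) S(t z) starts at 1 and ends at exp (- z) S(z); in its derivative
the terms cancel in pairs, up to the last one, which is small. *)
Lemma exp_sum_bound z n :
  cmodulus (cexp z - exp_sum n.+1 z) <=
  2 * (cmodulus z * expR (2 * cmodulus z)) * (cmodulus z ^+ n / n`!%:R).
Proof.
pose F (t : R) := cexp (- (t%:C * z)) * exp_sum n.+1 (t%:C * z).
pose d (t : R) := - (z * cexp (- (t%:C * z)) * ((t%:C * z) ^+ n / n`!%:R)).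
have Fd t : cderiv F t (d t).
  have e1 : cderiv (fun t : R => t%:C * z) t z.
    by apply: cderiv_eq (cderivM (cderiv_real t) (cderiv_cst z t)) _; rewrite mul1r mulr0 addr0.
  apply: cderiv_eq (cderivM (cderiv_exp (cderivN e1)) (exp_sum_deriv n z t)) _.
  by rewrite /d {1}/exp_sum big_ord_recr /= -/(exp_sum n _); ring.
have h : cmodulus (F 1 - F 0) <=
    2 * (cmodulus z * expR (cmodulus z) * (cmodulus z ^+ n / n`!%:R)) * (1 - 0).
  apply: mean_value ltr01 (fun t _ => Fd t) _ => t /andP[t0 t1].
  have tz : cmodulus (t%:C * z) <= cmodulus z.
    by rewrite cmodM cmodR ger0_norm // ler_piMl ?cmod_ge0.
  rewrite /d cmodN cmodM cmod_fact cmodM cmod_cexp.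
  apply: ler_pM; rewrite ?mulr_ge0 ?cmod_ge0 ?expR_ge0 ?divr_ge0 ?exprn_ge0 ?cmod_ge0 //.
    rewrite ler_wpM2l ?cmod_ge0 // ler_expR ReN.
    apply: le_trans tz; apply: le_trans (Re_le_cmod _).
    by rewrite -[leRHS]normrN ler_norm.
  by rewrite ler_wpM2r ?invr_ge0 // lerXn2r ?nnegrE ?cmod_ge0.
have F1 : F 1 = cexp (- z) * exp_sum n.+1 z by rewrite /F mul1r.
have F0 : F 0 = 1.
  rewrite /F mul0r oppr0 cexp0 mul1r /exp_sum big_ord_recl big1 ?addr0 ?expr0 ?divr1 //.
  by move=> k _; rewrite expr0n /= mul0r.
have -> : cexp z - exp_sum n.+1 z = cexp z * (F 0 - F 1).
  by rewrite F0 F1 mulrBr mulr1 mulrA -cexpD subrr cexp0 mul1r.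
have -> : expR (2 * cmodulus z) = expR (cmodulus z) * expR (cmodulus z).
  by rewrite mulr_natl mulr2n expRD.
rewrite cmodM cmodB cmod_cexp.
apply: (le_trans (ler_wpM2l (expR_ge0 _) h)).
have -> : 2 * (cmodulus z * (expR (cmodulus z) * expR (cmodulus z))) * (cmodulus z ^+ n / n`!%:R) =
   expR (cmodulus z) * (2 * (cmodulus z * expR (cmodulus z) * (cmodulus z ^+ n / n`!%:R)) * (1 - 0)) by ring.
rewrite ler_wpM2r ?ler_expR //; last exact: le_trans (ler_norm _) (Re_le_cmod _).
by rewrite !mulr_ge0 ?cmod_ge0 ?expR_ge0 ?exprn_ge0 ?cmod_ge0 ?invr_ge0 ?subr_ge0.
Qed.

Lemma exp_sum_cvg z : ccvg (fun n => exp_sum n z) (cexp z).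
Proof.
apply/ccvgP => e e0.
pose b n := 2 * (cmodulus z * expR (2 * cmodulus z)) * (cmodulus z ^+ n / n`!%:R).
have b0 : b @ \oo --> 0.
  rewrite -[0](mulr0 (2 * (cmodulus z * expR (2 * cmodulus z)))).
  apply: cvgM; first exact: cvg_cst.
  exact: (cvg_exp_coeff (cmodulus z)).
move/cvgrPdist_lt : b0 => /(_ _ e0)[N _ hN]; exists N.+1 => -[//|n] /hN /=.
rewrite sub0r normrN cmodB; apply: le_lt_trans.
exact: le_trans (exp_sum_bound z n) (ler_norm _).
Qed.

End ExpSeries.

(** * Integrals of exponentials as power series *)

Section ExpIntegral.
Variable R : realType.
Local Notation mu := (@lebesgue_measure R).
Implicit Types (D : set R) (L h : R -> R[i]) (s : R[i]).

(** The condition under which the integral of exp (u L) h is an entire function of u. *)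
Definition exp_dominated D L h : Prop :=
  [/\ measurable D, (forall x, D x -> exists d, cderiv L x d),
      (forall x, D x -> exists d, cderiv h x d) &
      forall r : R, exists2 G : R -> R, mu.-integrable D (EFin \o G) &
        forall x, D x -> expR (r * cmodulus (L x)) * cmodulus (h x) <= G x].

Lemma cmod_cexp_le s (z : R[i]) : cmodulus (cexp (s * z)) <= expR (cmodulus s * cmodulus z).
Proof.
rewrite cmod_cexp ler_expR; apply: le_trans (ler_norm _) _.
by apply: le_trans (Re_le_cmod _) _; rewrite cmodM.
Qed.

Section Fixed.
Variables (D : set R) (L h : R -> R[i]).
Hypothesis H : exp_dominated D L h.

Let mD : measurable D. Proof. by case: H. Qed.

Lemma exp_moment_measurable s n :
  cmeasurable D (fun x => L x ^+ n * cexp (s * L x) * h x).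
Proof.
case: H => _ HL Hh _; apply: cderiv_measurable => // x Dx.
have [d hd] := HL x Dx; have [e he] := Hh x Dx; eexists.
exact: (cderivM (cderivM (cderivX n hd) (cderiv_exp (cderivZ s hd))) he).
Qed.

(** One more exponential absorbs the power, since |L|^n <= n! exp |L|. *)
Lemma exp_moment_integrable s n :
  cintegrable D (fun x => L x ^+ n * cexp (s * L x) * h x).
Proof.
case: (H) => _ HL Hh HG; have [G iG hG] := HG (1 + cmodulus s).
apply: (@cintegrable_le _ _ mD _ (fun x => n`!%:R * G x)).
- exact: exp_moment_measurable.
- exact: integrableZ.
- move=> x Dx; rewrite !cmodM cmodX.
  have n0 : (0 : R) < n`!%:R by rewrite ltr0n fact_gt0.
  apply: le_trans (ler_wpM2l (ltW n0) (hG x Dx)).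
  rewrite mulrA ler_wpM2r ?cmod_ge0 // mulrDl mul1r expRD mulrA.
  apply: ler_pM; rewrite ?exprn_ge0 ?cmod_ge0 ?cmod_cexp_le //.
  rewrite mulrC -ler_pdivrMr //.
  apply: le_trans (exp_sum_real n.+1 (cmod_ge0 (L x))).
  by rewrite big_ord_recr /= lerDr sumr_ge0 // => k _; rewrite divr_ge0 ?exprn_ge0 ?cmod_ge0.
Qed.

(** Expand exp ((s - s0) L) under the integral sign: its partial sums are dominated by
exp (|s - s0| |L|). *)
Lemma exp_integral_series s0 s :
  ccvg (fun n => \sum_(k < n) cintegral D (fun x => L x ^+ k * cexp (s0 * L x) * h x) / k`!%:R
      * (s - s0) ^+ k)
    (cintegral D (fun x => cexp (s * L x) * h x)).
Proof.
case: (H) => _ HL Hh HG.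
pose u k x := ((s - s0) ^+ k / k`!%:R) * (L x ^+ k * cexp (s0 * L x) * h x).
have iu k : cintegrable D (u k).
  by apply: cintegrableZ => //; exact: exp_moment_integrable.
have [G iG hG] := HG (cmodulus (s - s0) + cmodulus s0).
have uE n x : \sum_(k < n) u k x = exp_sum n ((s - s0) * L x) * (cexp (s0 * L x) * h x).
  rewrite /exp_sum mulr_suml; apply: eq_bigr => k _; rewrite /u exprMn; ring.
apply: (@ccvg_eq _ (fun n => cintegral D (fun x => \sum_(k < n) u k x))).
  move=> n; have [_ ->] := cintegral_sum mD n iu.
  apply: eq_bigr => k _; rewrite /u cintegralZ //; last exact: exp_moment_integrable.
  ring.
apply: (@cdominated R D mD _ _ G) => [n|x Dx| |n x Dx].
- have [[i1 _] _] := cintegral_sum mD n iu; have [[_ i2] _] := cintegral_sum mD n iu.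
  by split; apply/measurable_EFinP; [exact: (measurable_int mu i1) | exact: (measurable_int mu i2)].
- have -> : cexp (s * L x) * h x = (cexp (s0 * L x) * h x) * cexp ((s - s0) * L x).
    by rewrite mulrC mulrAC -cexpD -mulrDl addrC subrK mulrC.
  apply: (@ccvg_eq _ (fun n => (cexp (s0 * L x) * h x) * exp_sum n ((s - s0) * L x))).
    by move=> n; rewrite uE mulrC.
  by apply: ccvgZ; exact: exp_sum_cvg.
- by [].
- rewrite uE; apply: le_trans (hG x Dx).
  rewrite mulrA !cmodM ler_wpM2r ?cmod_ge0 // [in leRHS]mulrDl expRD.
  apply: ler_pM; rewrite ?cmod_ge0 ?cmod_cexp_le //.
  by rewrite -cmodM cmod_exp_sum.
Qed.

End Fixed.
End ExpIntegral.

(** * Uniqueness of power series *)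

Section PowerSeries.
Variable R : realType.
Implicit Types (a b : nat -> R[i]) (z s l : R[i]) (D Z F : R[i] -> R[i]).

Definition pseries_to a z l : Prop := ccvg (fun n => \sum_(k < n) a k * z ^+ k) l.

(** The terms of a convergent series are bounded. *)
Lemma pseries_coef_bound a z l : pseries_to a z l ->
  exists M : R, forall k, cmodulus (a k) * cmodulus z ^+ k <= M.
Proof.
move=> /ccvgP /(_ _ ltr01) [N hN].
exists (2 + \sum_(k < N) cmodulus (a k) * cmodulus z ^+ k) => k.
have p0 j : 0 <= cmodulus (a j) * cmodulus z ^+ j by rewrite mulr_ge0 ?exprn_ge0 ?cmod_ge0.
have [kN|Nk] := ltnP k N.
  rewrite (bigD1 (Ordinal kN)) //= addrCA lerDl addr_ge0 // sumr_ge0 //.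
rewrite -cmodX -cmodM.
have h1 := hN _ Nk; have h2 := hN _ (leqW Nk).
have -> : a k * z ^+ k = (\sum_(j < k.+1) a j * z ^+ j - l) - (\sum_(j < k) a j * z ^+ j - l).
  by rewrite big_ord_recr /=; ring.
have s0 : 0 <= \sum_(k < N) cmodulus (a k) * cmodulus z ^+ k by rewrite sumr_ge0.
apply: le_trans (cmodBD _ _) _; lra.
Qed.

Lemma geometric_half (q : R) n : 0 <= q <= 2^-1 -> \sum_(k < n) q ^+ k <= 2.
Proof.
move=> /andP[q0 q1]; suff: \sum_(k < n) q ^+ k <= 2 - 2 * 2^-1 ^+ n.
  by move/le_trans; apply; rewrite lerBlDr lerDl mulr_ge0 // exprn_ge0.
elim: n => [|n IH]; first by rewrite big_ord0 expr0; lra.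
rewrite big_ord_recr /=.
have h : q ^+ n <= 2^-1 ^+ n by rewrite lerXn2r ?nnegrE.
rewrite exprS; lra.
Qed.

(** If a m is the first nonzero coefficient, then at a zero z the term a m z^m is
balanced by the later ones, which are of order |z|^(m + 1); this fails for z small. *)
Lemma pseries_zero a (rho M : R) : 0 < rho ->
  (forall k, cmodulus (a k) * rho ^+ k <= M) ->
  (forall e : R, 0 < e -> exists2 z, 0 < cmodulus z < e & pseries_to a z 0) ->
  forall k, a k = 0.
Proof.
move=> r0 aM hz; suff main m : (forall j, (j < m)%N -> a j = 0) -> a m = 0.
  by move=> k; elim/ltn_ind: k => k IH; exact: main.
move=> IH; apply/eqP/negPn/negP => am; have {}am : 0 < cmodulus (a m) by rewrite cmod_gt0.
have M0 : 0 <= M by apply: le_trans (aM 0); rewrite mulr_ge0 ?exprn_ge0 ?cmod_ge0 ?ltW.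
(* The second bound is what contradicts the estimate of the first nonzero term. *)
pose e := Num.min (rho / 2) (cmodulus (a m) * rho ^+ m.+1 / (2 * M + 1)).
have M1 : 0 < 2 * M + 1 by lra.
have e0 : 0 < e by rewrite lt_min !divr_gt0 ?mulr_gt0 ?exprn_gt0.
have [z /andP[z0]] := hz e e0.
rewrite lt_min => /andP[z1]; rewrite ltr_pdivlMr // => z2 hs.
pose x := cmodulus z; pose q := x / rho.
have xq : x = q * rho by rewrite /q mulfVK ?gt_eqF.
have q0 : 0 < q by rewrite divr_gt0.
have q1 : q <= 2^-1 by rewrite ler_pdivrMr // mulrC ltW.
have key : cmodulus (a m) * x ^+ m <= 2 * M * q ^+ m.+1.
  rewrite leNgt; apply/negP => lt.
  have d0 : 0 < cmodulus (a m) * x ^+ m - 2 * M * q ^+ m.+1 by rewrite subr_gt0.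
  have [N hN] := (ccvgP _ _).1 hs _ d0.
  have := hN (m.+1 + N)%N (leq_addl _ _).
  rewrite subr0 big_split_ord /= big_ord_recr /= big1 ?add0r; last first.
    by move=> j _; rewrite IH ?mul0r.
  apply/negP; rewrite -leNgt.
  set A := a m * _; set B := \sum_(i < N) _.
  have AE : cmodulus A = cmodulus (a m) * x ^+ m by rewrite cmodM cmodX.
  have hA : cmodulus A - cmodulus B <= cmodulus (A + B).
    by rewrite -[B in leRHS]opprK -(cmodN B) cmod_sub.
  suff hB : cmodulus B <= 2 * M * q ^+ m.+1 by lra.
  apply: le_trans (cmod_sum _ _ _) _.
  apply: (@le_trans _ _ (\sum_(i < N) M * q ^+ m.+1 * q ^+ i)).
    apply: ler_sum => i _; rewrite cmodM cmodX -/x xq exprMn -mulrA -exprD.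
    rewrite [leLHS]mulrCA mulrC ler_wpM2r ?exprn_ge0 ?(ltW q0) //.
  rewrite -mulr_sumr [leRHS](_ : _ = M * q ^+ m.+1 * 2); last by ring.
  rewrite ler_wpM2l ?mulr_ge0 ?exprn_ge0 ?(ltW q0) //.
  by apply: geometric_half; rewrite (ltW q0) q1.
have r1 : 0 < rho ^+ m.+1 by rewrite exprn_gt0.
have x0 : 0 < x ^+ m by rewrite exprn_gt0.
have : cmodulus (a m) * rho ^+ m.+1 * x ^+ m <= 2 * M * x * x ^+ m.
  rewrite -[leRHS]mulrA -exprS [X in _ <= _ * X ^+ _]xq exprMn.
  have -> : cmodulus (a m) * rho ^+ m.+1 * x ^+ m = cmodulus (a m) * x ^+ m * rho ^+ m.+1 by ring.
  by rewrite mulrA ler_wpM2r // ltW.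
rewrite ler_pM2r // => h; move: (lt_le_trans z2 h); rewrite -/x mulrDr mulr1.
have : 0 < x by []. lra.
Qed.

Lemma pseries_unique a b (f : R[i] -> R[i]) (r : R) : 0 < r ->
  (forall z, 0 < cmodulus z < r -> pseries_to a z (f z)) ->
  (forall z, 0 < cmodulus z < r -> pseries_to b z (f z)) -> forall k, a k = b k.
Proof.
move=> r0 ha hb k; apply/eqP; rewrite -subr_eq0; apply/eqP.
have h z : 0 < cmodulus z < r -> pseries_to (fun k => a k - b k) z 0.
  move=> zr; have := ccvgD (ha z zr) (ccvgZ (-1) (hb z zr)).
  rewrite mulN1r subrr; apply: ccvg_eq => n.
  by rewrite mulr_sumr -big_split /=; apply: eq_bigr => i _; rewrite mulrBl mulN1r.
have z1 (e : R) : 0 < e -> cmodulus e%:C = e by move=> e0; rewrite cmodR gtr0_norm.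
have r2 : 0 < r / 2 by lra.
have hr : 0 < cmodulus (r / 2)%:C < r by rewrite z1 //; apply/andP; split; lra.
have [M hM] := pseries_coef_bound (h _ hr).
apply: (@pseries_zero (fun k => a k - b k) (r / 2) M) => // [j|e e0].
  by have := hM j; rewrite z1.
have m0 : 0 < Num.min r e / 2 by rewrite divr_gt0 // lt_min r0 e0.
have m1 : Num.min r e / 2 < Num.min r e by lra.
exists (Num.min r e / 2)%:C; first by rewrite z1 // m0 (lt_le_trans m1) // ge_min lexx orbT.
by apply: h; rewrite z1 // m0 (lt_le_trans m1) // ge_min lexx.
Qed.

Lemma analytic_atP Z z : analytic_at Z z <->
  exists2 r : R, 0 < r & exists a, forall w, cmodulus (w - z) < r -> pseries_to a (w - z) (Z w).
Proof.
split=> -[r r0 [a ha]]; exists r => //; exists a => w wr.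
  apply: (cseries_toP (fun n => a n * (w - z) ^+ n) _).1; apply: ha.
  by rewrite normCE ltcR.
apply: (cseries_toP (fun n => a n * (w - z) ^+ n) _).2; apply: ha.
by rewrite normCE ltcR in wr.
Qed.

Lemma analytic_atD Z F z : analytic_at Z z -> analytic_at F z ->
  analytic_at (fun s => Z s + F s) z.
Proof.
move=> /analytic_atP[r r0 [a ha]] /analytic_atP[r' r0' [b hb]].
apply/analytic_atP; exists (Num.min r r'); first by rewrite lt_min r0.
exists (fun k => a k + b k) => w; rewrite lt_min => /andP[w1 w2].
apply: ccvg_eq (ccvgD (ha w w1) (hb w w2)) => n.
by rewrite -big_split /=; apply: eq_bigr => i _; rewrite mulrDl.
Qed.

Lemma analytic_atZ (c : R[i]) Z z : analytic_at Z z -> analytic_at (fun s => c * Z s) z.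
Proof.
move=> /analytic_atP[r r0 [a ha]].
apply/analytic_atP; exists r => //.
exists (fun k => c * a k) => w /ha /(ccvgZ c); apply: ccvg_eq => n.
by rewrite mulr_sumr; apply: eq_bigr => i _; rewrite mulrA.
Qed.

Definition vanishes D z := exists2 r : R, 0 < r & forall w, cmodulus (w - z) < r -> D w = 0.

Lemma analytic_isolated D z : analytic_at D z ->
  (forall e : R, 0 < e -> exists2 w, 0 < cmodulus (w - z) < e & D w = 0) -> vanishes D z.
Proof.
move=> /analytic_atP[r r0 [a ha]] hz.
have r2 : 0 < r / 2 by lra.
have e1 : z + (r / 2)%:C - z = (r / 2)%:C by ring.
have c1 : cmodulus (r / 2)%:C = r / 2 by rewrite cmodR gtr0_norm.
have [|M hM] := pseries_coef_bound (ha (z + (r / 2)%:C) _); first by rewrite e1 c1; lra.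
have a0 k : a k = 0.
  apply: (@pseries_zero a (r / 2) M) => // [j|e e0]; first by have := hM j; rewrite e1 c1.
  have m0 : 0 < Num.min r e by rewrite lt_min r0 e0.
  have [w /andP[w0 wm] Dw] := hz _ m0.
  exists (w - z); first by rewrite w0 (lt_le_trans wm) // ge_min lexx orbT.
  by rewrite -Dw; apply: ha; rewrite (lt_le_trans wm) // ge_min lexx.
exists r => // w /ha h; apply: (ccvg_unique h).
apply: (@ccvg_eq _ (fun=> 0)); last exact: ccvg_cst.
by move=> n; rewrite big1 // => i _; rewrite a0 mul0r.
Qed.

End PowerSeries.

(** * The identity theorem off the point 1 *)

Section IdentityTheorem.
Variable R : realType.
Implicit Types (z s p : R[i]) (D Z F : R[i] -> R[i]).

Lemma vanishes_near D z w (r : R) : (forall w, cmodulus (w - z) < r -> D w = 0) ->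
  cmodulus (w - z) < r -> vanishes D w.
Proof.
move=> h wr; exists (r - cmodulus (w - z)); first by rewrite subr_gt0.
move=> u hu; apply: h; have -> : u - z = (u - w) + (w - z) by ring.
by apply: le_lt_trans (cmodD _ _) _; lra.
Qed.

(** Let T be the supremum of the parameters up to which D vanishes around every point
of the segment.  The zeros of D accumulate at the point of parameter T, so D
vanishes around it too, hence also a little beyond unless T = 1. *)
Lemma segment_vanishes D p s :
  (forall t : R, 0 <= t <= 1 -> analytic_at D (p + t%:C * (s - p))) ->
  vanishes D p -> D s = 0.
Proof.
move=> hD hp; have [sp|sp] := eqVneq s p.
  by have [r r0 hr] := hp; apply: hr; rewrite sp subrr cmod0.
pose m := cmodulus (s - p); have m0 : 0 < m by rewrite cmod_gt0 subr_eq0.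
pose g (t : R) := p + t%:C * (s - p).
have gB t t' : cmodulus (g t - g t') = `|t - t'| * m.
  have -> : g t - g t' = (t - t')%:C * (s - p) by rewrite /g rmorphB; ring.
  by rewrite cmodM cmodR.
have g0 : g 0 = p by rewrite /g mul0r addr0.
have g1 : g 1 = s by rewrite /g mul1r addrC subrK.
pose S : set R := [set t | 0 <= t <= 1 /\ forall u, 0 <= u <= t -> vanishes D (g u)].
have S0 : S 0.
  split; first by rewrite lexx ler01.
  by move=> u; rewrite -eq_le => /eqP <-; rewrite g0.
have ubS : ubound S 1 by move=> t [/andP[]].
have supS : has_sup S by split; [exists 0 | exists 1].
pose T := sup S.
have T0 : 0 <= T by apply: sup_ubound => //; exists 1.
have T1 : T <= 1 by apply: ge_sup => //; exists 0.
have below u : 0 <= u < T -> vanishes D (g u).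
  move=> /andP[u0 uT]; have d0 : 0 < T - u by rewrite subr_gt0.
  have [t [_ St] ut] := sup_adherent d0 supS.
  by apply: St; rewrite u0 ltW //; move: ut; rewrite -/T; lra.
(* The parameters T - d with d small give zeros of D accumulating at g T. *)
have atT : vanishes D (g T).
  move: T0; rewrite le_eqVlt => /predU1P[<-|T0]; first by rewrite g0.
  apply: analytic_isolated; first by apply: hD; rewrite ltW.
  move=> e e0; pose d := Num.min T (e / m) / 2.
  have min0 : 0 < Num.min T (e / m) by rewrite lt_min T0 divr_gt0.
  have m1 : Num.min T (e / m) <= T by rewrite ge_min lexx.
  have m2 : Num.min T (e / m) <= e / m by rewrite ge_min lexx orbT.
  have d0 : 0 < d by rewrite /d; lra.
  exists (g (T - d)).
    have -> : cmodulus (g (T - d) - g T) = d * m.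
      by rewrite gB addrAC subrr sub0r normrN gtr0_norm.
    by rewrite mulr_gt0 //= -ltr_pdivlMr // /d; lra.
  have [|r r0 hr] := below (T - d); first by rewrite /d; apply/andP; split; lra.
  by apply: hr; rewrite subrr cmod0.
have [r r0 hr] := atT.
have near u : `|u - T| * m < r -> vanishes D (g u).
  by move=> h; apply: (vanishes_near hr); rewrite gB.
suff T1' : T = 1 by rewrite -g1 -T1'; apply: hr; rewrite subrr cmod0.
apply/eqP; rewrite eq_le T1 leNgt /=; apply/negP => Tlt.
pose d := Num.min (1 - T) (r / m) / 2.
have min0 : 0 < Num.min (1 - T) (r / m) by rewrite lt_min divr_gt0 // subr_gt0 Tlt.
have m1 : Num.min (1 - T) (r / m) <= 1 - T by rewrite ge_min lexx.
have m2 : Num.min (1 - T) (r / m) <= r / m by rewrite ge_min lexx orbT.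
have d0 : 0 < d by rewrite /d; lra.
have : S (T + d).
  split; first by rewrite /d; apply/andP; split; lra.
  move=> u /andP[u0 u1]; have [uT|uT] := ltP u T; first by apply: below; rewrite u0.
  apply: near; rewrite ger0_norm ?subr_ge0 // -ltr_pdivlMr //.
  by move: u1; rewrite /d; lra.
move=> /(sup_ubound (ex_intro _ 1 ubS)); rewrite -/T; lra.
Qed.

(** A point off 1 is joined to the half-plane Re > 1 by a segment that avoids 1: from 2
if the point is not real, from 2 + i if it is real. *)
Lemma identity_off_one Z F :
  (forall s, s != 1 -> analytic_at Z s) -> (forall s, s != 1 -> analytic_at F s) ->
  (forall s, 1 < Re s -> Z s = F s) -> forall s, s != 1 -> Z s = F s.
Proof.
move=> hZ hF ZF s s1; pose D w := Z w + (-1) * F w.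
suff: D s = 0 by rewrite /D mulN1r => /eqP; rewrite subr_eq0 => /eqP.
have hD w : w != 1 -> analytic_at D w.
  by move=> w1; apply: analytic_atD (hZ _ w1) (analytic_atZ _ (hF _ w1)).
have vD p : 1 < Re p -> vanishes D p.
  move=> p1; exists (Re p - 1); first by rewrite subr_gt0.
  move=> w hw; rewrite /D ZF ?mulN1r ?subrr //.
  have := le_lt_trans (Re_le_cmod (w - p)) hw.
  by rewrite ReD ReN ltr_norml => /andP[]; lra.
have neq1 (w : R[i]) : (Re w != 1) || (Im w != 0) -> w != 1.
  by move=> h; apply: contraTneq h => ->; rewrite Re1 Im1 !eqxx.
have [im0|im0] := eqVneq (Im s) 0.
  apply: (@segment_vanishes D (2 +i* 1)); last by apply: vD => /=; lra.
  move=> t /andP[t0 t1]; apply: hD; apply: neq1; rewrite !ReImE !ReImC /= im0.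
  have [->|tn1] := eqVneq t 1.
    apply/orP; left; apply: contraNneq s1 => e; apply/eqP/complex_ext; rewrite //= -[RHS]e; ring.
  by apply/orP; right; apply/eqP => e; move/eqP: tn1; apply; lra.
apply: (@segment_vanishes D (2 +i* 0)); last by apply: vD => /=; lra.
move=> t /andP[t0 t1]; apply: hD; apply: neq1; rewrite !ReImE !ReImC /=.
have [->|tn0] := eqVneq t 0.
  by apply/orP; left; apply/eqP; lra.
apply/orP; right; have -> : 0 + (t * (Im s - 0) + 0 * (Re s - 2)) = t * Im s by ring.
by rewrite mulf_neq0.
Qed.

End IdentityTheorem.

(** * The theorem of Cauchy on rectangles *)

Section Rectangle.
Variable R : realType.
Local Notation mu := (@lebesgue_measure R).
Variables (j : R[i]) (K Kd : R -> R -> R[i]) (al be M : R).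
Hypothesis Kdy : forall y x : R, 0 <= y <= 1 -> al < x < be -> cderiv (fun y => K y x) y (Kd y x).
Hypothesis Kdx : forall y x : R, 0 <= y <= 1 -> al < x < be -> cderiv (fun x => K y x) x (j * Kd y x).
Hypothesis Kddy : forall y x : R, 0 <= y <= 1 -> al < x < be ->
  exists d, cderiv (fun y => Kd y x) y d.
Hypothesis KdM : forall y x : R, 0 <= y <= 1 -> al < x < be -> cmodulus (j * Kd y x) <= M.

Lemma real_under_integral (f df : R -> R -> R) (x : R) : al < x < be ->
  (forall u, al < u < be -> mu.-integrable `[0, 1] (EFin \o f u)) ->
  (forall u y : R, al < u < be -> 0 <= y <= 1 -> is_derive u 1 (f ^~ y) (df u y)) ->
  (forall u y : R, al < u < be -> 0 <= y <= 1 -> `|df u y| <= M) ->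
  is_derive x 1 (fun u => \int[mu]_(y in `[0, 1]) f u y) (\int[mu]_(y in `[0, 1]) df x y).
Proof.
move=> xab intf der bnd.
have Ix : `]al, be[%classic x by rewrite /= in_itv.
have iI u : `]al, be[%classic u -> al < u < be by rewrite /= in_itv.
have i01 y : `[0, 1]%classic y -> 0 <= y <= 1 by rewrite /= in_itv.
have d1 u y : `]al, be[%classic u -> `[0, 1]%classic y -> derivable (f ^~ y) u 1.
  by move=> /iI hu /i01 hy; have [] := der u y hu hy.
have dE u y : al < u < be -> 0 <= y <= 1 -> partial1of2 f u y = df u y.
  by move=> hu hy; rewrite partial1of2E; have [_ ->] := der u y hu hy.
have intf' u : `]al, be[%classic u -> mu.-integrable `[0, 1] (EFin \o f u).
  by move=> /iI; exact: intf.
have M0 : 0 <= M.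
  by apply: le_trans (bnd x 0 xab _); rewrite ?lexx ?ler01.
have iM : mu.-integrable `[0, 1] (EFin \o (fun=> M) : R -> \bar R).
  exact: segment_cst_integrable.
have ub u y : `]al, be[%classic u -> `[0, 1]%classic y -> `|partial1of2 f u y| <= (fun=> M) y.
  by move=> /iI hu /i01 hy; rewrite dE // bnd.
have m01 : measurable (`[0, 1]%classic : set R) by [].
have H1 := @derivable_under_integral R _ _ mu f _ m01 x al be Ix intf' d1 (fun=> M) (fun _ => M0) iM ub.
have H2 := @differentiation_under_integral R _ _ mu f _ m01 x al be Ix intf' d1 (fun=> M) (fun _ => M0) iM ub.
apply: DeriveDef; first exact: H1.
rewrite -derive1E H2; apply: eq_Rintegral => y /set_mem /i01 hy.
by rewrite dE.
Qed.

(** Differentiating in x under the integral sign gives j times the integral of the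
derivative in y, which the fundamental theorem of calculus evaluates. *)
Lemma rectangle_deriv x : al < x < be ->
  cderiv (fun x => cintegral `[0, 1] (fun y => K y x)) x (j * (K 1 x - K 0 x)).
Proof.
move=> hx; have i01 y : `[0, 1]%classic y -> 0 <= y <= 1 by rewrite /= in_itv.
have [i1 e1] : cintegrable `[0, 1] (fun y => Kd y x) /\
    cintegral `[0, 1] (fun y => Kd y x) = K 1 x - K 0 x.
  apply: (@cFTC R 0 1 (fun y => Kd y x) (fun y => K y x)); first exact: ltr01.
    by move=> y hy; exact: Kdy.
  by move=> y hy; exact: Kddy.
have iK u : al < u < be -> cintegrable `[0, 1] (fun y => K y u).
  by move=> hu; apply: segment_integrable => y hy; eexists; exact: Kdy.
rewrite -e1 -cintegralZ //; split.
  apply: (@real_under_integral (fun u y => Re (K y u)) (fun u y => Re (j * Kd y u))) => //.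
  - by move=> u /iK[].
  - by move=> u y hu hy; have [] := Kdx hy hu.
  - by move=> u y hu hy; exact: le_trans (Re_le_cmod _) (KdM hy hu).
apply: (@real_under_integral (fun u y => Im (K y u)) (fun u y => Im (j * Kd y u))) => //.
- by move=> u /iK[].
- by move=> u y hu hy; have [] := Kdx hy hu.
- by move=> u y hu hy; exact: le_trans (Im_le_cmod _) (KdM hy hu).
Qed.

Lemma rectangle_integral a b : al < a -> a < b -> b < be ->
  cintegrable `[a, b] (fun x => j * (K 1 x - K 0 x)) /\
  cintegral `[a, b] (fun x => j * (K 1 x - K 0 x)) =
  cintegral `[0, 1] (fun y => K y b) - cintegral `[0, 1] (fun y => K y a).
Proof.
move=> a1 ab b1; have hx x : a <= x <= b -> al < x < be by move=> /andP[h1 h2]; lra.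
have h01 : 0 <= (1 : R) <= 1 by rewrite lexx ler01.
have h00 : 0 <= (0 : R) <= 1 by rewrite lexx ler01.
apply: (@cFTC R a b _ (fun x => cintegral `[0, 1] (fun y => K y x)) ab) => x /hx hx'.
  exact: rectangle_deriv.
by exists (j * (j * Kd 1 x - j * Kd 0 x)); apply: cderivZ; apply: cderivB; apply: Kdx.
Qed.

End Rectangle.

(** * Growth of the logarithm and the weight *)

Section Weight.
Variable R : realType.
Local Notation mu := (@lebesgue_measure R).
Implicit Types (a z c j s : R[i]) (x y p r : R).

(** Because ln m = ln (m / r) + ln r and ln t < t, a multiple r ln m is at most m up to
a constant.  The coefficient 1 of the modulus, whatever r, is what lets the weight
prevail. *)
Lemma clog_growth r p : 0 < p -> exists2 C : R, 0 <= C &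
  forall z, p <= Re z -> r * cmodulus (clog z) <= cmodulus z + C.
Proof.
move=> p0; have [r0|r0] := leP r 0.
  exists 0 => // z _; rewrite addr0; apply: le_trans (cmod_ge0 _).
  by rewrite mulr_le0_ge0 ?cmod_ge0.
exists (r * (`|ln r| + p^-1 + pi)).
  apply: mulr_ge0; first exact: ltW.
  by apply: addr_ge0; [apply: addr_ge0; [exact: normr_ge0 | rewrite invr_ge0 ltW] | exact: pi_ge0].
move=> z pz; have z0 : 0 < Re z by apply: lt_le_trans p0 pz.
have zN0 := Re_gt0_neq0 z0.
have m0 : 0 < cmodulus z by rewrite cmod_gt0.
have pm : p <= cmodulus z by apply: le_trans pz (le_trans (ler_norm _) (Re_le_cmod z)).
have h1 : r * ln (cmodulus z) <= cmodulus z + r * `|ln r|.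
  have -> : ln (cmodulus z) = ln (cmodulus z / r) + ln r.
    by rewrite ln_div ?posrE // subrK.
  rewrite mulrDr lerD //; last by rewrite ler_wpM2l ?(ltW r0) // ler_norm.
  have : ln (cmodulus z / r) <= cmodulus z / r by rewrite ltW // ln_sublinear // divr_gt0.
  by move=> /(ler_wpM2l (ltW r0)); rewrite mulrCA divff ?mulr1 ?gt_eqF.
have h2 : - ln (cmodulus z) <= p^-1.
  rewrite -lnV ?posrE //; apply: (@le_trans _ _ (cmodulus z)^-1).
    by rewrite ltW // ln_sublinear // invr_gt0.
  by rewrite lef_pV2 // posrE.
have h3 : r * `|ln (cmodulus z)| <= cmodulus z + r * `|ln r| + r * p^-1.
  have [l0|l0] := leP 0 (ln (cmodulus z)).
    rewrite ger0_norm //; apply: le_trans h1 _.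
    by rewrite lerDl mulr_ge0 ?invr_ge0 ?(ltW r0) ?(ltW p0).
  rewrite ltr0_norm //; apply: (le_trans (ler_wpM2l (ltW r0) h2)).
  by rewrite lerDr addr_ge0 ?cmod_ge0 ?mulr_ge0 ?normr_ge0 ?(ltW r0).
have h4 : r * `|carg z| <= r * pi.
  by rewrite ler_wpM2l ?(ltW r0) // ler_norml; exact: carg_pi.
have := ler_wpM2l (ltW r0) (cmod_le (clog z)); rewrite Re_clog Im_clog.
move: h3 h4; lra.
Qed.

Lemma cpow_growth c p : 0 < p -> exists2 C : R, 0 <= C &
  forall z, p <= Re z -> cmodulus (cpow z c) <= expR (cmodulus z + C).
Proof.
move=> p0; have [C C0 hC] := clog_growth (cmodulus c) p0; exists C => // z pz.
by apply: le_trans (cmod_cexp_le _ _) _; rewrite ler_expR hC.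
Qed.

Definition fermi x : R := (expR (2 * pi * x) + 1)^-1.

Lemma fermi_gt0 x : 0 < fermi x.
Proof. by rewrite invr_gt0 ltr_wpDl ?expR_ge0. Qed.

Lemma fermi_le x : 0 <= x -> fermi x <= expR (- (2 * x)).
Proof.
move=> x0; have h : 0 < expR (2 * pi * x) + 1 by rewrite ltr_wpDl ?expR_ge0.
rewrite /fermi expRN lef_pV2 ?posrE ?expR_gt0 //.
apply: (@le_trans _ _ (expR (2 * pi * x))); last by rewrite lerDl.
rewrite ler_expR ler_wpM2r // ler_peMr //; have := @pi_ge2 R; lra.
Qed.

Lemma fermi_deriv x : exists d, cderiv (fun x => (fermi x)%:C) x d.
Proof.
have e1 : cderiv (fun x => cexp ((2 * pi)%:C * x%:C) + 1) x
    ((2 * pi)%:C * 1 * cexp ((2 * pi)%:C * x%:C) + 0).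
  by apply: cderivD; [apply: cderiv_exp; apply: cderivZ; exact: cderiv_real | exact: cderiv_cst].
have eE t : cexp ((2 * pi)%:C * t%:C) + 1 = (expR (2 * pi * t) + 1)%:C :> R[i].
  by rewrite -rmorphM cexpR [RHS]rmorphD [in RHS]rmorph1.
rewrite (_ : (fun x => (fermi x)%:C) = fun x => (cexp ((2 * pi)%:C * x%:C) + 1)^-1).
  eexists; apply: cderivV e1; rewrite eE -[0]/((0 : R)%:C) (inj_eq (@complexI R)).
  by rewrite gt_eqF // ltr_wpDl ?expR_ge0.
by apply/funext => t; rewrite eE /fermi fmorphV.
Qed.

Lemma integrable_expN : mu.-integrable `[0, +oo[ (EFin \o (fun x : R => expR (- x))).
Proof.
have h := @integrable_exponential_pdf R 1 ltr01.
have mI : measurable (`[0, +oo[%classic : set R) by [].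
have := @integrableS _ _ _ mu _ _ _ measurableT mI (@subsetT _ _) h.
apply: eq_integrable => // x /set_mem; rewrite /= in_itv /= andbT => x0.
by rewrite /= exponential_pdfE // mul1r mulN1r.
Qed.

Lemma integrable_fermi : mu.-integrable `[0, +oo[ (EFin \o fermi).
Proof.
have [m1 _] : cmeasurable `[0, +oo[ (fun x => (fermi x)%:C).
  by apply: cderiv_measurable => // x _; exact: fermi_deriv.
apply: le_integrable integrable_expN => //; first exact/measurable_EFinP.
move=> x; rewrite /= in_itv /= andbT => x0; rewrite lee_fin.
rewrite !ger0_norm ?expR_ge0 ?(ltW (fermi_gt0 _)) //.
apply: (le_trans (fermi_le x0)); rewrite ler_expR; lra.
Qed.

Section Line.
Variables (a j : R[i]).
Hypotheses (a0 : 0 < Re a) (j0 : Re j = 0) (j1 : cmodulus j = 1).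

Lemma Re_line x : Re (a + j * x%:C) = Re a.
Proof. by rewrite !ReImE !ReImC j0; ring. Qed.

Lemma line_deriv x : cderiv (fun x => a + j * x%:C) x j.
Proof.
apply: cderiv_eq (cderivD (cderiv_cst a x) (cderivZ j (cderiv_real x))) _.
by rewrite add0r mulr1.
Qed.

Lemma cmod_line x : 0 <= x -> cmodulus (a + j * x%:C) <= cmodulus a + x.
Proof.
move=> x0; apply: le_trans (cmodD _ _) _.
by rewrite cmodM j1 mul1r cmodR ger0_norm.
Qed.

(** The exponential grows at most like exp x, and the weight decays like exp (-2 x). *)
Lemma line_dominated : exp_dominated `[0, +oo[ (fun x => clog (a + j * x%:C))
  (fun x => (fermi x)%:C).
Proof.
split => [//|x _|x _|r].
- eexists; apply: cderiv_log; last exact: line_deriv.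
  by rewrite Re_line.
- exact: fermi_deriv.
have [C C0 hC] := clog_growth r a0.
exists (fun x => expR (cmodulus a + C) * expR (- x)).
  by apply: integrableZ => //; exact: integrable_expN.
move=> x; rewrite /= in_itv /= andbT => x0.
rewrite cmodR (ger0_norm (ltW (fermi_gt0 _))) -expRD.
apply: (@le_trans _ _ (expR (cmodulus a + x + C) * expR (- (2 * x)))).
  apply: ler_pM; rewrite ?expR_ge0 ?(ltW (fermi_gt0 _)) ?fermi_le //.
  rewrite ler_expR; apply: le_trans (hC _ _) _; first by rewrite Re_line.
  by rewrite lerD2r cmod_line.
by rewrite -expRD ler_expR; lra.
Qed.

Lemma line_pow_integrable c :
  cintegrable `[0, +oo[ (fun x => cpow (a + j * x%:C) c * (fermi x)%:C).
Proof.
apply: eq_cintegrable (exp_moment_integrable line_dominated c 0) => // x _.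
by rewrite expr0 mul1r.
Qed.

End Line.
End Weight.

(** * The kernel on half a strip *)

Section Kernel.
Variable R : realType.
Local Notation mu := (@lebesgue_measure R).

(** For j = i or j = -i, the points z = a + y + j x with 0 <= y <= 1 and 0 <= x fill the
upper or the lower half of the strip.  As j^2 = -1, [strip_exp] is
exp (-2 pi j (z - a)): it equals exp (2 pi x) on both vertical edges and -1 at the
middle of the base, the only pole of [strip_kernel]. *)
Definition strip_pt (a j : R[i]) (y x : R) : R[i] := a + y%:C + j * x%:C.
Definition strip_exp (j : R[i]) (y x : R) : R[i] := cexp ((2 * pi)%:C * (x%:C - j * y%:C)).
Definition strip_kernel (a s j : R[i]) (y x : R) : R[i] :=
  cpow (strip_pt a j y x) (- s) * (1 + strip_exp j y x)^-1.

Variables (a j : R[i]).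
Hypotheses (a0 : 0 < Re a) (j0 : Re j = 0) (j1 : cmodulus j = 1).
Implicit Types (s c : R[i]) (x y : R).

Lemma sqr_unit_imag : j * j = -1.
Proof.
have := cmod_sqr j; rewrite j1 j0 expr0n /= add0r expr1n => e.
apply: complex_ext; rewrite !ReImE !ReImC j0 mul0r ?mulr0 ?add0r ?addr0 ?oppr0 //.
by rewrite -expr2 -e.
Qed.

Lemma Re_strip_pt y x : Re (strip_pt a j y x) = Re a + y.
Proof. by rewrite !ReImE !ReImC j0; ring. Qed.

Lemma Re_strip_pt_ge y x : 0 <= y -> Re a <= Re (strip_pt a j y x).
Proof. by move=> y0; rewrite Re_strip_pt lerDl. Qed.

Lemma Re_strip_pt_gt y x : 0 <= y -> 0 < Re (strip_pt a j y x).
Proof. by move=> y0; apply: lt_le_trans a0 (Re_strip_pt_ge x y0). Qed.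

Lemma cmod_strip_pt y x : 0 <= y <= 1 -> 0 <= x -> cmodulus (strip_pt a j y x) <= cmodulus a + 1 + x.
Proof.
move=> /andP[y0 y1] x0; apply: le_trans (cmodD _ _) _.
rewrite cmodM j1 mul1r cmodR ger0_norm // lerD2r.
by apply: le_trans (cmodD _ _) _; rewrite cmodR ger0_norm // lerD2l.
Qed.

Lemma cmod_strip_exp y x : cmodulus (strip_exp j y x) = expR (2 * pi * x).
Proof. by rewrite cmod_cexp !ReImE !ReImC j0; congr expR; ring. Qed.

Lemma strip_exp_lower y x : 0 <= x -> expR (2 * pi * x) - 1 <= cmodulus (1 + strip_exp j y x).
Proof.
move=> x0; rewrite -(cmod_strip_exp y x) [1 + _]addrC -[1 in leRHS]opprK.
by apply: le_trans (cmod_sub _ _); rewrite cmodN cmod1.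
Qed.

Lemma strip_exp_neq0 y x : 0 < x -> 1 + strip_exp j y x != 0.
Proof.
move=> x0; rewrite -cmod_gt0; apply: lt_le_trans (strip_exp_lower y (ltW x0)).
by rewrite subr_gt0 expR_gt1 !mulr_gt0 ?pi_gt0.
Qed.

Lemma strip_pt_deriv_y y x : cderiv (fun y => strip_pt a j y x) y 1.
Proof.
apply: cderiv_eq (cderivD (cderivD (cderiv_cst a y) (cderiv_real y)) (cderiv_cst (j * x%:C) y)) _.
by rewrite add0r addr0.
Qed.

Lemma strip_pt_deriv_x y x : cderiv (fun x => strip_pt a j y x) x j.
Proof.
apply: cderiv_eq (cderivD (cderiv_cst (a + y%:C) x) (cderivZ j (cderiv_real x))) _.
by rewrite add0r mulr1.
Qed.

Lemma strip_exp_deriv_y y x : cderiv (fun y => strip_exp j y x) y (- ((2 * pi)%:C * j) * strip_exp j y x).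
Proof.
apply: cderiv_eq (cderiv_exp (cderivZ (2 * pi)%:C
  (cderivB (cderiv_cst x%:C y) (cderivZ j (cderiv_real y))))) _.
by rewrite -/(strip_exp j y x) sub0r mulr1 mulrN.
Qed.

Lemma strip_exp_deriv_x y x : cderiv (fun x => strip_exp j y x) x ((2 * pi)%:C * strip_exp j y x).
Proof.
apply: cderiv_eq (cderiv_exp (cderivZ (2 * pi)%:C
  (cderivB (cderiv_real x) (cderiv_cst (j * y%:C) x)))) _.
by rewrite -/(strip_exp j y x) subr0 mulr1.
Qed.

(** The complex derivative of the kernel with respect to z. *)
Definition strip_kernel_d s y x : R[i] :=
  - s * cpow (strip_pt a j y x) (- s) / strip_pt a j y x * (1 + strip_exp j y x)^-1 +
  cpow (strip_pt a j y x) (- s) * ((2 * pi)%:C * j * strip_exp j y x / (1 + strip_exp j y x) ^+ 2).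

Lemma strip_kernel_deriv_y s y x : 0 <= y -> 1 + strip_exp j y x != 0 ->
  cderiv (fun y => strip_kernel a s j y x) y (strip_kernel_d s y x).
Proof.
move=> y0 k0; apply: cderiv_eq.
  exact: (cderivM (@cderiv_pow R (fun y => strip_pt a j y x) y 1 (- s) (Re_strip_pt_gt x y0) (strip_pt_deriv_y y x))
    (@cderivV R (fun y => 1 + strip_exp j y x) y _ k0 (cderivD (cderiv_cst 1 y) (strip_exp_deriv_y y x)))).
by rewrite /strip_kernel_d; congr (_ + _); rewrite ?mulr1 // add0r !mulNr !opprK.
Qed.

Lemma strip_kernel_deriv_x s y x : 0 <= y -> 1 + strip_exp j y x != 0 ->
  cderiv (fun x => strip_kernel a s j y x) x (j * strip_kernel_d s y x).
Proof.
move=> y0 k0; apply: cderiv_eq.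
  exact: (cderivM (@cderiv_pow R (fun x => strip_pt a j y x) x j (- s) (Re_strip_pt_gt x y0) (strip_pt_deriv_x y x))
    (@cderivV R (fun x => 1 + strip_exp j y x) x _ k0 (cderivD (cderiv_cst 1 x) (strip_exp_deriv_x y x)))).
rewrite /strip_kernel_d [RHS]mulrDr add0r; congr (_ + _); first by ring.
have -> : j * (cpow (strip_pt a j y x) (- s) * ((2 * pi)%:C * j * strip_exp j y x / (1 + strip_exp j y x) ^+ 2)) =
  (j * j) * (cpow (strip_pt a j y x) (- s) * ((2 * pi)%:C * strip_exp j y x / (1 + strip_exp j y x) ^+ 2)) by ring.
by rewrite sqr_unit_imag; ring.
Qed.

Lemma strip_kernel_d_deriv s y x : 0 <= y -> 1 + strip_exp j y x != 0 ->
  exists d, cderiv (fun y => strip_kernel_d s y x) y d.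
Proof.
move=> y0 k0; have g0 := Re_strip_pt_gt x y0; eexists.
have gd := strip_pt_deriv_y y x; have gp := @cderiv_pow R (fun y => strip_pt a j y x) y 1 (- s) g0 gd.
have e1 := cderivD (cderiv_cst 1 y) (strip_exp_deriv_y y x).
apply: cderivD.
  apply: cderivM; last exact: (@cderivV R (fun y => 1 + strip_exp j y x) y _ k0 e1).
  apply: cderivM; first exact: (cderivZ (- s) gp).
  exact: (@cderivV R (fun y => strip_pt a j y x) y 1 (Re_gt0_neq0 g0) gd).
apply: (cderivM gp); apply: cderivM; first exact: (cderivZ _ (strip_exp_deriv_y y x)).
by apply: cderivV; [rewrite expf_neq0 | exact: (cderivX 2 e1)].
Qed.

Lemma strip_kernel_d_bound s al be : 0 < al -> exists M : R, forall y x, 0 <= y <= 1 -> al < x < be ->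
  cmodulus (j * strip_kernel_d s y x) <= M.
Proof.
move=> al0; have [C C0 hC] := cpow_growth (- s) a0.
pose G : R := expR (cmodulus a + 1 + be + C); pose Q : R := expR (2 * pi * al) - 1.
pose B : R := expR (2 * pi * be).
have Q0 : 0 < Q by rewrite subr_gt0 expR_gt1 !mulr_gt0 ?pi_gt0.
exists (cmodulus s * G / Re a * Q^-1 + G * (2 * pi * B * (Q ^- 2))).
move=> y x hy /andP[x1 x2]; have [y0 y1] := andP hy.
have x0 : 0 < x by lra.
have pi2 : 0 < 2 * pi :> R by rewrite mulr_gt0 ?pi_gt0.
have gG : cmodulus (cpow (strip_pt a j y x) (- s)) <= G.
  apply: le_trans (hC _ (Re_strip_pt_ge x y0)) _; rewrite ler_expR.
  by have := cmod_strip_pt hy (ltW x0); lra.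
have qQ : cmodulus (1 + strip_exp j y x)^-1 <= Q^-1.
  rewrite cmodV lef_pV2 ?posrE ?cmod_gt0 ?strip_exp_neq0 //.
  apply: le_trans (strip_exp_lower y (ltW x0)); rewrite lerD2r ler_expR.
  by rewrite ler_wpM2l // ltW.
have eB : cmodulus (strip_exp j y x) <= B by rewrite cmod_strip_exp ler_expR ler_wpM2l // ltW.
have aG : cmodulus (strip_pt a j y x)^-1 <= (Re a)^-1.
  rewrite cmodV lef_pV2 ?posrE ?cmod_gt0 ?(Re_gt0_neq0 (Re_strip_pt_gt x y0)) //.
  by apply: le_trans (Re_strip_pt_ge x y0) (le_trans (ler_norm _) (Re_le_cmod _)).
rewrite cmodM j1 mul1r; apply: le_trans (cmodD _ _) _; apply: lerD.
  rewrite !cmodM cmodN.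
  apply: ler_pM; rewrite ?mulr_ge0 ?cmod_ge0 //.
  apply: ler_pM; rewrite ?mulr_ge0 ?cmod_ge0 //.
  by apply: ler_pM; rewrite ?cmod_ge0.
rewrite !cmodM j1 mulr1 cmodR (gtr0_norm pi2) -exprVn cmodX -[Q ^- 2]exprVn.
apply: ler_pM; rewrite ?mulr_ge0 ?cmod_ge0 ?exprn_ge0 ?cmod_ge0 ?pi_ge0 //.
apply: ler_pM; rewrite ?mulr_ge0 ?cmod_ge0 ?exprn_ge0 ?cmod_ge0 ?pi_ge0 //.
  by apply: ler_pM; rewrite ?cmod_ge0 ?(ltW pi2).
by rewrite lerXn2r ?nnegrE ?cmod_ge0 ?invr_ge0 ?(ltW Q0).
Qed.

Definition kernel_mean s x : R[i] := cintegral `[0, 1] (fun y => strip_kernel a s j y x).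

(** The theorem of Cauchy on a rectangle that stays away from the pole. *)
Lemma strip_kernel_integral s al be : 0 < al -> al < be ->
  cintegrable `[al, be] (fun x => j * (strip_kernel a s j 1 x - strip_kernel a s j 0 x)) /\
  cintegral `[al, be] (fun x => j * (strip_kernel a s j 1 x - strip_kernel a s j 0 x)) =
  kernel_mean s be - kernel_mean s al.
Proof.
move=> al0 ab; have al2 : 0 < al / 2 by lra.
have [M hM] := strip_kernel_d_bound s (be + 1) al2.
have hh y x : 0 <= y <= 1 -> al / 2 < x < be + 1 -> 0 <= y /\ 1 + strip_exp j y x != 0.
  by move=> /andP[y0 _] /andP[x0 _]; rewrite strip_exp_neq0 //; lra.
apply: (@rectangle_integral R j (strip_kernel a s j) (strip_kernel_d s) (al / 2) (be + 1) M) => //.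
- by move=> y x hy hx; have [? ?] := hh y x hy hx; exact: strip_kernel_deriv_y.
- by move=> y x hy hx; have [? ?] := hh y x hy hx; exact: strip_kernel_deriv_x.
- by move=> y x hy hx; have [? ?] := hh y x hy hx; exact: strip_kernel_d_deriv.
- lra.
- lra.
Qed.

Lemma cexp_2pij : cexp ((2 * pi)%:C * j) = 1.
Proof.
have := sqr_unit_imag; move=> /(congr1 (@complex.Re R)); rewrite ReM j0 ReN Re1 mul0r sub0r => /oppr_inj e.
have im : `|Im j| = 1.
  by apply/eqP; rewrite -sqrp_eq1 ?normr_ge0 // real_normK ?num_real // expr2 e.
apply: complex_ext; rewrite ?cexpE ?cexpEi ReM ImM ReC ImC j0 !mulr0 !mul0r subr0 addr0 expR0 mul1r.
  have -> : 2 * pi * Im j = Im j * (pi *+ 2) by ring.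
  move: im; case: (ler0P (Im j)) => _ im; last by rewrite im mul1r cos2pi.
  by rewrite -cosN -mulNr im mul1r cos2pi.
have -> : 2 * pi * Im j = Im j * (pi *+ 2) by ring.
move: im; case: (ler0P (Im j)) => _ im; last by rewrite im mul1r sin2pi.
by apply: oppr_inj; rewrite -sinN -mulNr im mul1r sin2pi oppr0.
Qed.

Lemma strip_exp0 x : strip_exp j 0 x = (expR (2 * pi * x))%:C.
Proof. by rewrite /strip_exp mulr0 subr0 -rmorphM cexpR. Qed.

Lemma strip_exp1 x : strip_exp j 1 x = (expR (2 * pi * x))%:C.
Proof. by rewrite /strip_exp mulr1 mulrBr cexpD cexpN cexp_2pij invr1 mulr1 -rmorphM cexpR. Qed.

Lemma strip_kernel_ends s x : strip_kernel a s j 1 x - strip_kernel a s j 0 x =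
  (cpow (a + 1 + j * x%:C) (- s) - cpow (a + j * x%:C) (- s)) * (fermi x)%:C.
Proof.
rewrite /strip_kernel strip_exp0 strip_exp1 /strip_pt !addr0 -mulrBl; congr (_ * _).
by rewrite /fermi fmorphV rmorphD rmorph1 addrC.
Qed.

(** The power grows at most like exp x, and the denominator at least like exp (2 x). *)
Lemma kernel_mean_cvgy s : ccvg (fun n => kernel_mean s n.+2%:R) 0.
Proof.
apply: ccvg0P; have [C C0 hC] := cpow_growth (- s) a0.
pose B : R := 2 * (2 * expR (cmodulus a + 1 + C)).
exists (fun n => B * expR (- n.+2%:R)).
  move=> n; set x : R := n.+2%:R.
  have x1 : 1 <= x by rewrite ler1n.
  have x0 : 0 < x by lra.
  have pi2 := @pi_ge2 R.
  have hb y : 0 <= y <= 1 -> cmodulus (strip_kernel a s j y x) <= 2 * expR (cmodulus a + 1 + C) * expR (- x).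
    move=> hy; have [y0 y1] := andP hy; rewrite cmodM cmodV.
    have e2 : 2 <= expR (2 * x) by apply: le_trans (expR_ge1Dx _); lra.
    have e3 : expR (2 * x) <= expR (2 * pi * x).
      by rewrite ler_expR ler_wpM2r ?(ltW x0) //; lra.
    have k0 : expR (2 * x) / 2 <= cmodulus (1 + strip_exp j y x).
      by apply: le_trans (strip_exp_lower y (ltW x0)); lra.
    have k1 : 0 < cmodulus (1 + strip_exp j y x) by rewrite cmod_gt0 strip_exp_neq0.
    rewrite ler_pdivrMr //.
    have e4 : 0 < 2 * expR (cmodulus a + 1 + C) * expR (- x) by rewrite !mulr_gt0 ?expR_gt0.
    apply: le_trans (ler_wpM2l (ltW e4) k0).
    rewrite [leRHS](_ : _ = expR (cmodulus a + 1 + C) * (expR (- x) * expR (2 * x))); last by field.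
    rewrite -!expRD; apply: le_trans (hC _ (Re_strip_pt_ge x y0)) _; rewrite ler_expR.
    by have := cmod_strip_pt hy (ltW x0); lra.
  have i01 y : `[0, 1]%classic y -> 0 <= y <= 1 by rewrite /= in_itv.
  have iK : cintegrable `[0, 1] (fun y => strip_kernel a s j y x).
    apply: segment_integrable => y /andP[y0 _].
    by eexists; exact: (strip_kernel_deriv_y _ y0 (strip_exp_neq0 y x0)).
  have iB := segment_cst_integrable 0 1 (2 * expR (cmodulus a + 1 + C) * expR (- x)).
  have m01 : measurable (`[0, 1]%classic : set R) by [].
  have := cmod_cintegral m01 iK iB (fun y hy => hb y (i01 y hy)).
  have mu1 : mu (`[0%R, 1%R]%classic : set R) = 1%E.
    by rewrite lebesgue_measure_itv /= lte_fin ltr01 /= oppr0 adde0.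
  rewrite Rintegral_cst //; set W := fine _.
  have -> : W = 1 by exact: (congr1 fine mu1).
  rewrite mulr1.
  by rewrite mulrA.
rewrite -[0](mulr0 B); apply: cvgM; first exact: cvg_cst.
have := @cvgn_expR R; rewrite -(cvg_shiftn 2).
by under eq_fun do rewrite addn2.
Qed.

End Kernel.

(** * The simple zero of the denominator *)

Section SmallHeight.
Variable R : realType.
Implicit Types (a j s c : R[i]) (x y u : R).

Definition cos_piquarter : R := cos (pi / 4).

Lemma cos_piquarter_gt0 : 0 < cos_piquarter.
Proof. by have := @pi_gt0 R => p; rewrite cos_gt0_pihalf //; apply/andP; split; lra. Qed.

Lemma sin_piquarter : sin (pi / 4) = cos_piquarter.
Proof.
by rewrite -cosBpihalf /cos_piquarter -(cosN (pi / 4)); congr cos; field.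
Qed.

(** The inequality of Jordan with a smaller constant: the mean value theorem applies up
to pi/4, where the cosine is at least cos (pi/4), and beyond pi/4 the sine increases. *)
Lemma sin_lower u : 0 <= u <= pi / 2 -> cos_piquarter / 2 * u <= sin u.
Proof.
have p := @pi_gt0 R; have c0 := cos_piquarter_gt0; have p2 := @pihalf_lt2 R.
move=> /andP[u0 u1]; have [u4|u4] := leP u (pi / 4).
  move: u0; rewrite le_eqVlt => /predU1P[<-|u0]; first by rewrite mulr0 sin0.
  have [t ht e] := @MVT R (@sin R) (@cos R) 0 u u0 (fun t _ => is_derive_sin t)
    (continuous_subspaceT (@continuous_sin R)).
  move: ht; rewrite in_itv /= => /andP[t0 t1].
  move: e; rewrite sin0 !subr0 => ->; rewrite ler_wpM2r ?(ltW u0) //.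
  apply: (@le_trans _ _ cos_piquarter); first by lra.
  have i1 : t \in `[0, pi] by rewrite in_itv /=; apply/andP; split; lra.
  have i2 : pi / 4 \in `[0, (pi : R)] by rewrite in_itv /=; apply/andP; split; lra.
  by rewrite leNgt /cos_piquarter (ltr_cos i2 i1) -leNgt; lra.
apply: (@le_trans _ _ cos_piquarter); first by rewrite mulrAC ler_pdivrMr // ler_wpM2l ?(ltW c0) //; lra.
rewrite -sin_piquarter leNgt ltr_sin ?in_itv /= -?leNgt ?(ltW u4) //; apply/andP; split; lra.
Qed.

Lemma cos_lower y : 0 <= y <= 1 -> (cos_piquarter * (y - 2^-1)) ^+ 2 <= cos (pi * y) ^+ 2.
Proof.
move=> /andP[y0 y1]; have p := @pi_gt0 R; have p2 := @pi_ge2 R; have c0 := cos_piquarter_gt0.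
have key u : 0 <= u <= 2^-1 -> cos_piquarter * u <= sin (pi * u).
  move=> /andP[u0 u1]; apply: le_trans (sin_lower _).
    by rewrite mulrAC -mulrA ler_wpM2l ?(ltW c0) // mulrAC ler_peMl //; lra.
  by rewrite mulr_ge0 ?(ltW p) //= ler_wpM2l ?(ltW p).
have sq u : 0 <= u <= 2^-1 -> (cos_piquarter * u) ^+ 2 <= sin (pi * u) ^+ 2.
  move=> hu; have k := key u hu; have k0 : 0 <= cos_piquarter * u.
    by rewrite mulr_ge0 ?(ltW c0) //; case/andP: hu.
  by rewrite lerXn2r ?nnegrE // (le_trans k0).
have [h|h] := leP y 2^-1.
  have -> : cos (pi * y) = sin (pi * (2^-1 - y)).
    by rewrite -cosN -sinDpihalf; congr sin; ring.
  rewrite -[leLHS]sqrrN -mulrN opprB; apply: sq; apply/andP; split; lra.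
have -> : cos (pi * y) = - sin (pi * (y - 2^-1)).
  by rewrite mulrBr sinBpihalf opprK.
by rewrite sqrrN; apply: sq; apply/andP; split; lra.
Qed.

Lemma sqr_Im_unit j : Re j = 0 -> cmodulus j = 1 -> Im j ^+ 2 = 1.
Proof. by move=> j0 j1; have := cmod_sqr j; rewrite j0 j1 expr0n /= add0r expr1n. Qed.

(** With rho = exp (2 pi x), the squared modulus of the denominator is
(rho - 1)^2 + 4 rho cos (pi y)^2, which bounds the squares of both coordinates of the
displacement from the middle of the base.  So the zero there is simple. *)
Lemma strip_exp_lower_dist j y x : Re j = 0 -> cmodulus j = 1 -> 0 <= y <= 1 -> 0 <= x ->
  cos_piquarter * cmodulus ((y - 2^-1)%:C + j * x%:C) <= cmodulus (1 + strip_exp j y x).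
Proof.
move=> j0 j1 hy x0; have c0 := cos_piquarter_gt0; have ij := sqr_Im_unit j0 j1.
rewrite -ler_sqr ?nnegrE ?mulr_ge0 ?cmod_ge0 ?(ltW c0) //.
rewrite exprMn !cmod_sqr !ReImE /strip_exp cexpE cexpEi !ReImE !ReImC j0.
set rho := expR _; set co := cos _; set si := sin _.
have rhoE : rho = expR (2 * pi * x) by congr expR; ring.
have siE : si ^+ 2 = 1 - co ^+ 2 by rewrite sin2cos2.
have coE : co = 2 * cos (pi * y) ^+ 2 - 1.
  have -> : 2 * cos (pi * y) ^+ 2 - 1 = cos ((pi * y) *+ 2) by rewrite cos_mulr2n mulr_natl.
  have : Im j = 1 \/ Im j = -1.
    by move/eqP: ij; rewrite sqrf_eq1 => /orP[/eqP|/eqP]; [left|right].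
  by case=> e; rewrite /co e; [rewrite -cosN|]; congr cos; ring.
have rho1 : 2 * pi * x <= rho - 1 by rewrite rhoE lerBrDr addrC expR_ge1Dx.
have p2 := @pi_ge2 R.
have cx : (cos_piquarter * x) ^+ 2 <= (rho - 1) ^+ 2.
  have c1 : cos_piquarter <= 1 by exact: cos_le1.
  have h1 : cos_piquarter * x <= rho - 1.
    apply: le_trans rho1; rewrite ler_wpM2r //; lra.
  by rewrite lerXn2r ?nnegrE ?mulr_ge0 ?(ltW c0) // (le_trans _ h1) // mulr_ge0 ?(ltW c0).
have r1 : 1 <= rho by have := mulr_ge0 (_ : 0 <= 2 * pi :> R) x0; lra.
have cl := cos_lower hy.
have rc : cos (pi * y) ^+ 2 <= rho * cos (pi * y) ^+ 2 by rewrite ler_peMl // sqr_ge0.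
have -> : (0 + (0 * 0 + Im j * x)) ^+ 2 = x ^+ 2.
  by rewrite mul0r !add0r exprMn ij mul1r.
have e1 : (1 + rho * co) ^+ 2 + (0 + rho * si) ^+ 2 = (rho - 1) ^+ 2 + 4 * (rho * cos (pi * y) ^+ 2).
  have -> : (0 + rho * si) ^+ 2 = rho ^+ 2 * si ^+ 2 by rewrite add0r exprMn.
  by rewrite siE coE; ring.
rewrite e1; move: cx cl rc; rewrite !exprMn.
have := sqr_ge0 (cos (pi * y)).
have -> : (y - 2^-1 + (0 * x - Im j * 0)) ^+ 2 = (y - 2^-1) ^+ 2 by congr (_ ^+ 2); ring.
lra.
Qed.

End SmallHeight.

(** * The limit on the axis of the strip *)

Section LimitAtZero.
Variable R : realType.
Local Notation mu := (@lebesgue_measure R).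
Implicit Types (a j s c : R[i]) (x y u : R).

Lemma halfC : (2^-1 : R)%:C = 2^-1 :> R[i].
Proof. by rewrite fmorphV rmorph_nat. Qed.

Lemma cpow0 (z : R[i]) : cpow z 0 = 1.
Proof. by rewrite /cpow mul0r cexp0. Qed.

Section OneSide.
Variables (a s j : R[i]).
Hypotheses (a0 : 0 < Re a) (j0 : Re j = 0) (j1 : cmodulus j = 1).

(** With exponent 0 the kernel takes the same values on the two vertical edges, so its
mean does not depend on the height; and it vanishes at infinity. *)
Lemma kernel_mean_pow0 x : 0 < x -> kernel_mean a j 0 x = 0.
Proof.
move=> x0; apply: (@ccvg_unique _ (fun n => kernel_mean a j 0 n.+2%:R)); last exact: kernel_mean_cvgy.
apply/ccvgP => e e0; exists (Num.trunc x).+1 => n hn.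
have xn : x < n.+2%:R.
  have := truncnS_gt x; move=> /lt_le_trans; apply.
  by rewrite ler_nat (leq_trans hn) // ltnW.
have [_] := strip_kernel_integral a0 j0 j1 0 x0 xn.
rewrite (@eq_cintegral _ _ _ (fun=> 0)) ?cintegral0 //; last first.
  by move=> t _; rewrite strip_kernel_ends // oppr0 !cpow0 subrr mul0r mulr0.
by move=> /esym/eqP; rewrite subr_eq0 => /eqP ->; rewrite subrr cmod0.
Qed.

(** Subtracting the value at the middle of the base removes the pole. *)
Definition kernel_sub y x : R[i] :=
  (cpow (strip_pt a j y x) (- s) - cpow (a + 2^-1) (- s)) * (1 + strip_exp j y x)^-1.

Lemma kernel_sub_deriv_y y x : 0 <= y -> 1 + strip_exp j y x != 0 ->
  exists d, cderiv (fun y => kernel_sub y x) y d.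
Proof.
move=> y0 k0; eexists; apply: cderivM.
  apply: (@cderivB R (fun y => cpow (strip_pt a j y x) (- s)) (fun=> _)); last exact: cderiv_cst.
  exact: (@cderiv_pow R (fun y => strip_pt a j y x) y 1 (- s) (Re_strip_pt_gt a0 j0 x y0) (strip_pt_deriv_y a j y x)).
exact: (@cderivV R (fun y => 1 + strip_exp j y x) y _ k0 (cderivD (cderiv_cst 1 y) (strip_exp_deriv_y j y x))).
Qed.

Lemma kernel_sub_deriv_x y x : 0 <= y -> 1 + strip_exp j y x != 0 ->
  exists d, cderiv (fun x => kernel_sub y x) x d.
Proof.
move=> y0 k0; eexists; apply: cderivM.
  apply: (@cderivB R (fun x => cpow (strip_pt a j y x) (- s)) (fun=> _)); last exact: cderiv_cst.
  exact: (@cderiv_pow R (fun x => strip_pt a j y x) x j (- s) (Re_strip_pt_gt a0 j0 x y0) (strip_pt_deriv_x a j y x)).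
exact: (@cderivV R (fun x => 1 + strip_exp j y x) x _ k0 (cderivD (cderiv_cst 1 x) (strip_exp_deriv_x j y x))).
Qed.

Lemma kernel_sub_integrable x : 0 < x -> cintegrable `[0, 1] (fun y => kernel_sub y x).
Proof.
move=> x0; apply: segment_integrable => y /andP[y0 _].
by apply: kernel_sub_deriv_y => //; exact: strip_exp_neq0.
Qed.

(** The subtracted constant multiplies the kernel of exponent 0, whose mean vanishes. *)
Lemma kernel_mean_sub x : 0 < x -> kernel_mean a j s x = cintegral `[0, 1] (fun y => kernel_sub y x).
Proof.
move=> x0; pose c := cpow (a + 2^-1) (- s).
have m01 : measurable (`[0, 1]%classic : set R) by [].
have iK t : cintegrable `[0, 1] (fun y => strip_kernel a t j y x).
  apply: segment_integrable => y /andP[y0 _]; eexists.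
  exact: (strip_kernel_deriv_y a0 j0 t y0 (strip_exp_neq0 j0 y x0)).
have -> : cintegral `[0, 1] (fun y => kernel_sub y x) =
    cintegral `[0, 1] (fun y => strip_kernel a s j y x - c * strip_kernel a 0 j y x).
  apply: eq_cintegral => y _; rewrite /kernel_sub /strip_kernel oppr0 cpow0 mul1r mulrBl //.
rewrite cintegralB //; last exact: cintegrableZ.
by rewrite cintegralZ // -[cintegral _ (fun y => strip_kernel a 0 j y x)]/(kernel_mean a j 0 x) kernel_mean_pow0 // mulr0 subr0.
Qed.

Lemma pow_lipschitz : exists2 M : R, 0 <= M & forall y x, 0 <= y <= 1 -> 0 <= x <= 1 ->
  cmodulus (cpow (strip_pt a j y x) (- s) - cpow (a + 2^-1) (- s)) <=
  M * cmodulus ((y - 2^-1)%:C + j * x%:C).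
Proof.
have [C C0 hC] := cpow_growth (- s) a0.
pose G : R := expR (cmodulus a + 2 + C).
exists (2 * (cmodulus s * G / Re a)).
  by rewrite mulr_ge0 // divr_ge0 ?(ltW a0) // mulr_ge0 ?cmod_ge0 ?expR_ge0.
move=> y x hy hx; set de := (y - 2^-1)%:C + j * x%:C.
have [y0 y1] := andP hy; have [x0 x1] := andP hx.
pose g (t : R) := (a + 2^-1) + t%:C * de.
have gd t : cderiv g t de.
  apply: cderiv_eq (cderivD (cderiv_cst (a + 2^-1) t) (cderivM (cderiv_real t) (cderiv_cst de t))) _.
  by rewrite mul1r mulr0 add0r addr0.
(* The segment stays in the half-plane where the power is controlled, because its ends do. *)
have Rg t : 0 <= t <= 1 -> Re a <= Re (g t).
  move=> /andP[t0 t1]; rewrite /g -halfC !ReImE !ReImC j0.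
  have : - (2^-1) <= t * (y - 2^-1); last by lra.
  have [h|h] := leP (2^-1) y.
    have : 0 <= t * (y - 2^-1) by rewrite mulr_ge0 // subr_ge0.
    lra.
  have : t * (2^-1 - y) <= 1 * (2^-1 - y) by rewrite ler_wpM2r //; lra.
  lra.
have cde : cmodulus de <= 2^-1 + 1.
  apply: le_trans (cmodD _ _) _; rewrite cmodM j1 mul1r !cmodR (ger0_norm x0).
  by apply: lerD => //; rewrite ler_norml; apply/andP; split; lra.
have cg t : 0 <= t <= 1 -> cmodulus (g t) <= cmodulus a + 2.
  move=> /andP[t0 t1]; apply: le_trans (cmodD _ _) _.
  have h1 : cmodulus (a + 2^-1) <= cmodulus a + 2^-1.
    by apply: le_trans (cmodD _ _) _; rewrite -halfC cmodR ger0_norm.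
  have h2 : cmodulus (t%:C * de) <= cmodulus de.
    by rewrite cmodM cmodR ger0_norm // ler_piMl ?cmod_ge0.
  lra.
have := @mean_value R 0 1 (cmodulus s * G / Re a * cmodulus de) (fun t => cpow (g t) (- s))
  (fun t => - s * de * cpow (g t) (- s) / g t) ltr01.
have -> : g 1 = strip_pt a j y x by rewrite /g /de /strip_pt rmorphB /= halfC; ring.
have -> : g 0 = a + 2^-1 by rewrite /g mul0r addr0.
rewrite subr0 mulr1 mulrA; apply.
  by move=> t ht; apply: cderiv_pow (gd t); apply: lt_le_trans a0 (Rg t ht).
move=> t ht; rewrite !cmodM cmodN.
rewrite [leRHS](_ : _ = cmodulus s * cmodulus de * G * (Re a)^-1); last by ring.
apply: ler_pM; rewrite ?mulr_ge0 ?cmod_ge0 //.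
  apply: ler_wpM2l; first by rewrite mulr_ge0 ?cmod_ge0.
  by apply: le_trans (hC _ (Rg t ht)) _; rewrite ler_expR; have := cg t ht; lra.
have gp : 0 < Re (g t) by apply: lt_le_trans a0 (Rg t ht).
rewrite cmodV lef_pV2 ?posrE ?cmod_gt0 ?Re_gt0_neq0 //.
by apply: le_trans (Rg t ht) (le_trans (ler_norm _) (Re_le_cmod _)).
Qed.

(** The numerator is Lipschitz, and the denominator is at least a multiple of the same
distance. *)
Lemma kernel_sub_bound : exists M : R, forall y x, 0 <= y <= 1 -> 0 < x <= 1 ->
  cmodulus (kernel_sub y x) <= M.
Proof.
have [M M0 hM] := pow_lipschitz; exists (M / cos_piquarter R) => y x hy /andP[x0 x1].
have c0 := cos_piquarter_gt0 R; have k0 := strip_exp_neq0 j0 y x0.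
rewrite cmodM cmodV ler_pdivrMr ?cmod_gt0 //.
apply: le_trans (hM y x hy _) _; first by rewrite ltW.
rewrite -mulrA ler_wpM2l // [leRHS]mulrC ler_pdivlMr // [leLHS]mulrC.
exact: strip_exp_lower_dist j0 j1 hy (ltW x0).
Qed.

End OneSide.

Lemma cintegral_setD1 (D : set R) r (f : R -> R[i]) : measurable D -> cintegrable D f ->
  cintegral (D `\ r) f = cintegral D f.
Proof.
move=> mD [f1 f2]; have mr : measurable (D `\ r) by exact: measurableD.
have key (h : R -> R) : mu.-integrable D (EFin \o h) ->
    \int[mu]_(x in D `\ r) h x = \int[mu]_(x in D) h x.
  move=> ih; rewrite /Rintegral integral_setD1 //.
  by apply: (measurable_funS mD); [exact: subDsetl | exact: (measurable_int mu ih)].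
by apply: complex_ext; rewrite /= key.
Qed.

Lemma cintegrable_setD1 (D : set R) r (f : R -> R[i]) : measurable D -> cintegrable D f ->
  cintegrable (D `\ r) f.
Proof.
move=> mD [f1 f2]; have mr : measurable (D `\ r) by exact: measurableD.
by split; [move: f1 | move: f2]; apply: integrableS => //; exact: subDsetl.
Qed.

(** On the axis the denominators of the two halves are 1 + u and 1 + 1/u, and their
inverses add up to 1. *)
Lemma kernel_sub_limit a s y : 0 < Re a -> 0 <= y <= 1 -> y != 2^-1 ->
  ccvg (fun n => kernel_sub a s 'i%C y (n.+1%:R^-1) + kernel_sub a s (- 'i%C) y (n.+1%:R^-1))
    (cpow (a + y%:C) (- s) - cpow (a + 2^-1) (- s)).
Proof.
move=> a0 hy yh; have [y0 _] := andP hy.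
have k0 (j : R[i]) : Re j = 0 -> cmodulus j = 1 -> 1 + strip_exp j y 0 != 0.
  move=> j0 j1; rewrite -cmod_gt0; apply: lt_le_trans (strip_exp_lower_dist j0 j1 hy (lexx 0)).
  by rewrite mulr_gt0 ?cos_piquarter_gt0 // mulr0 addr0 cmodR normr_gt0 subr_eq0.
have i0 : Re ('i%C : R[i]) = 0 by [].
have i1 := @cmodi R.
have ni0 : Re (- 'i%C : R[i]) = 0 by rewrite ReN oppr0.
have ni1 : cmodulus (- 'i%C : R[i]) = 1 by rewrite cmodN.
have [d hd] := kernel_sub_deriv_x s a0 i0 y0 (k0 _ i0 i1).
have [d' hd'] := kernel_sub_deriv_x s a0 ni0 y0 (k0 _ ni0 ni1).
have := ccvgD (cvg_ccvg hd (@cvg_harmonic R)) (cvg_ccvg hd' (@cvg_harmonic R)).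
have -> : kernel_sub a s 'i%C y 0 + kernel_sub a s (- 'i%C) y 0 =
   cpow (a + y%:C) (- s) - cpow (a + 2^-1) (- s); last by [].
rewrite /kernel_sub /strip_pt !mulr0 !addr0 -mulrDr -[RHS]mulr1; congr (_ * _).
have e : strip_exp (- 'i%C) y 0 = (strip_exp 'i%C y 0)^-1.
  by rewrite /strip_exp -cexpN -[(0 : R)%:C]/(0 : R[i]) !sub0r mulNr opprK mulrN opprK.
have := k0 _ i0 i1; rewrite e; have : strip_exp 'i%C y 0 != 0 by exact: cexp_neq0.
by move: (strip_exp 'i%C y 0) => u u0 u1; field; rewrite u0 [u + 1]addrC u1.
Qed.

(** Dominated convergence off the middle of the base, a null set on which the pointwise
limit is not controlled. *)
Lemma kernel_mean_cvg0 a s : 0 < Re a ->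
  ccvg (fun n => kernel_mean a 'i%C s (n.+1%:R^-1) + kernel_mean a (- 'i%C) s (n.+1%:R^-1))
    (cintegral `[0, 1] (fun y => cpow (a + y%:C) (- s) - cpow (a + 2^-1) (- s))).
Proof.
move=> a0.
have i0 : Re ('i%C : R[i]) = 0 by [].
have i1 := @cmodi R.
have ni0 : Re (- 'i%C : R[i]) = 0 by rewrite ReN oppr0.
have ni1 : cmodulus (- 'i%C : R[i]) = 1 by rewrite cmodN.
have m01 : measurable (`[0, 1]%classic : set R) by [].
pose D := `[0, 1]%classic `\ (2^-1 : R).
have mD : measurable D by exact: measurableD.
have h0 n : 0 < (n.+1%:R^-1 : R) <= 1 by rewrite invr_gt0 ltr0n /= invf_le1 ?ler1n ?ltr0n.
have [M hM] := kernel_sub_bound s a0 i0 i1; have [M' hM'] := kernel_sub_bound s a0 ni0 ni1.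
pose U n y := kernel_sub a s 'i%C y (n.+1%:R^-1) + kernel_sub a s (- 'i%C) y (n.+1%:R^-1).
have iU n : cintegrable `[0, 1] (U n).
  have [p _] := andP (h0 n).
  by apply: cintegrableD => //; apply: kernel_sub_integrable.
have iD y : D y -> 0 <= y <= 1 /\ y != 2^-1.
  by move=> [] /=; rewrite in_itv /= => ? /eqP.
apply: (@ccvg_eq _ (fun n => cintegral D (U n))).
  move=> n; have [p _] := andP (h0 n); rewrite cintegral_setD1 // cintegralD //.
  - by rewrite !kernel_mean_sub.
  - exact: kernel_sub_integrable.
  - exact: kernel_sub_integrable.
rewrite -(@cintegral_setD1 _ 2^-1) //; last first.
  apply: segment_integrable => y /andP[y0 _]; eexists.
  have e : cderiv (fun y : R => a + y%:C) y (0 + 1) by apply: cderivD; [exact: cderiv_cst | exact: cderiv_real].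
  have r0 : 0 < Re (a + y%:C) by rewrite ReD ReC ltr_wpDr.
  exact: (cderivB (@cderiv_pow R (fun y => a + y%:C) y _ (- s) r0 e) (cderiv_cst _ y)).
apply: (@cdominated R D mD U _ (fun=> M + M')).
- move=> n; have [[i3 _] [_ i4]] := (cintegrable_setD1 (2^-1) m01 (iU n), cintegrable_setD1 (2^-1) m01 (iU n)).
  by split; apply/measurable_EFinP; [exact: (measurable_int mu i3) | exact: (measurable_int mu i4)].
- by move=> y /iD [hy yh]; exact: kernel_sub_limit.
- have iM := segment_cst_integrable 0 1 (M + M').
  by move: iM; apply: integrableS => //; exact: subDsetl.
- move=> n y /iD [hy _]; apply: le_trans (cmodD _ _) _.
  by apply: lerD; [exact: hM | exact: hM'].
Qed.

End LimitAtZero.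

(** * The difference equation *)

Section DifferenceEquation.
Variable R : realType.
Local Notation mu := (@lebesgue_measure R).
Implicit Types (a s c : R[i]) (x y : R).

(** The segments exhaust the open half-line only; its endpoint is a null set. *)
Lemma Rintegral_exhaust (h : R -> R) : mu.-integrable `[0, +oo[ (EFin \o h) ->
  (fun n => \int[mu]_(x in `[n.+1%:R^-1, n.+2%:R]) h x) @ \oo --> \int[mu]_(x in `[0, +oo[) h x.
Proof.
move=> ih; pose D := `]0, +oo[%classic : set R.
have mD : measurable D by exact: measurable_itv.
have iD : mu.-integrable D (EFin \o h).
  by move: ih; apply: integrableS => // x; rewrite /D /= !in_itv /= !andbT; exact: ltW.
rewrite -(Rintegral_itv_obnd_cbnd iD).
pose P n : set R := `[n.+1%:R^-1, n.+2%:R]%classic.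
have mP n : measurable (P n) by exact: measurable_itv.
rewrite (_ : (fun n => _) = fun n => \int[mu]_(x in D) (h \_ (P n)) x); last first.
  apply/funext => n; rewrite -Rintegral_mkcondr; congr Rintegral.
  apply/seteqP; split => x; rewrite /D /P /= !in_itv /= ?andbT; last by case.
  move=> /andP[h1 h2]; split; last by rewrite h1.
  by apply: lt_le_trans h1; rewrite invr_gt0 ltr0n.
apply: (@Rdominated R D mD _ _ (fun x => `|h x|)).
- move=> n; apply/measurable_restrict => //.
  have mh : measurable_fun D h by apply/measurable_EFinP; exact: (measurable_int mu iD).
  by move: mh; apply: measurable_funS => //; exact: subIsetl.
- move=> x; rewrite /D /= in_itv /= andbT => x0.
  apply/cvgrPdist_lt => e e0.
  exists (maxn (Num.trunc x^-1) (Num.trunc x)) => // n /=; rewrite geq_max => /andP[n1 n2].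
  rewrite patchE mem_set ?subrr ?normr0 //.
  rewrite /P /= in_itv /=; apply/andP; split.
    rewrite -[leRHS]invrK lef_pV2 ?posrE ?invr_gt0 ?ltr0n //.
    by apply/ltW; apply: lt_le_trans (truncnS_gt _) _; rewrite ler_nat ltnS.
  by apply/ltW; apply: lt_le_trans (truncnS_gt _) _; rewrite ler_nat ltnS ltnW.
- exact: integrable_norm.
- by move=> n x _; rewrite patchE; case: ifP => // _; rewrite normr0.
Qed.

Lemma cintegral_exhaust (f : R -> R[i]) : cintegrable `[0, +oo[ f ->
  ccvg (fun n => cintegral `[n.+1%:R^-1, n.+2%:R] f) (cintegral `[0, +oo[ f).
Proof. by move=> [f1 f2]; split; exact: Rintegral_exhaust. Qed.

Definition line_diff a s x : R[i] :=
  (cpow (a + - 'i%C * x%:C) (- s) - cpow (a + 'i%C * x%:C) (- s)) * (fermi x)%:C.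

Definition hurwitz_rep a s : R[i] :=
  cpow a (1 - s) / (s - 1) + 'i%C * cintegral `[0, +oo[ (line_diff a s).

Lemma Re_Ni : Re (- 'i%C : R[i]) = 0. Proof. by rewrite ReN oppr0. Qed.
Lemma cmod_Ni : cmodulus (- 'i%C : R[i]) = 1. Proof. by rewrite cmodN cmodi. Qed.

Lemma line_diff_integrable a s : 0 < Re a -> cintegrable `[0, +oo[ (line_diff a s).
Proof.
move=> a0.
apply: (@eq_cintegrable _ _ _ (fun x => cpow (a + - 'i%C * x%:C) (- s) * (fermi x)%:C -
  cpow (a + 'i%C * x%:C) (- s) * (fermi x)%:C)) => //.
  by move=> x _; rewrite /line_diff mulrBl.
apply: cintegrableB => //; apply: line_pow_integrable => //.
- exact: Re_Ni.
- exact: cmod_Ni.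
- exact: cmodi.
Qed.

Lemma cpowS (z s : R[i]) : z != 0 -> cpow z (1 - s) = z * cpow z (- s).
Proof. by move=> z0; rewrite /cpow mulrDl mul1r cexpD cexp_clog. Qed.

Lemma pow_integral a s : 0 < Re a -> s != 1 ->
  cintegrable `[0, 1] (fun y => cpow (a + y%:C) (- s)) /\
  cintegral `[0, 1] (fun y => cpow (a + y%:C) (- s)) =
  (cpow a (1 - s) - cpow (a + 1) (1 - s)) / (s - 1).
Proof.
move=> a0 s1; have s10 : 1 - s != 0 by rewrite subr_eq0 eq_sym.
have ad y : cderiv (fun y : R => a + y%:C) y 1.
  by apply: cderiv_eq (cderivD (cderiv_cst a y) (cderiv_real y)) _; rewrite add0r.
have r0 y : 0 <= y -> 0 < Re (a + y%:C) by move=> y0; rewrite ReD ReC ltr_wpDr.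
have [||i1 e1] := @cFTC R 0 1 (fun y => cpow (a + y%:C) (- s))
   (fun y => (1 - s)^-1 * cpow (a + y%:C) (1 - s)) ltr01 _ _.
- move=> y /andP[y0 _].
  apply: cderiv_eq (cderivZ (1 - s)^-1 (@cderiv_pow R (fun y => a + y%:C) y 1 (1 - s) (r0 y y0) (ad y))) _.
  rewrite cpowS ?Re_gt0_neq0 ?r0 //.
  by field; rewrite s10 Re_gt0_neq0 ?r0.
- move=> y /andP[y0 _]; eexists.
  exact: (@cderiv_pow R (fun y => a + y%:C) y 1 (- s) (r0 y y0) (ad y)).
split => //; rewrite e1 addr0 -[(1 : R)%:C]/(1 : R[i]).
by field; rewrite s10 subr_eq0 s1.
Qed.

(** The theorem of Cauchy for the two halves of the strip, added up and taken to the
limit: the mean at height infinity vanishes, and the mean on the axis is the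
integral of (a + y)^(-s), a difference of powers, minus the residue term. *)
Lemma hurwitz_step a s : 0 < Re a -> s != 1 ->
  hurwitz_rep a s - hurwitz_rep (a + 1) s = cpow (a + 2^-1) (- s).
Proof.
move=> a0 s1; have a1 : 0 < Re (a + 1) by rewrite ReD Re1 addr_gt0.
have i0 : Re ('i%C : R[i]) = 0 by [].
have i1 := @cmodi R; have ni0 := Re_Ni; have ni1 := cmod_Ni.
pose pi_ x := 'i%C * (strip_kernel a s 'i%C 1 x - strip_kernel a s 'i%C 0 x).
pose ni_ x := - 'i%C * (strip_kernel a s (- 'i%C) 1 x - strip_kernel a s (- 'i%C) 0 x).
have m0y : measurable (`[0, +oo[%classic : set R) by [].
have ia := line_diff_integrable s a0; have ia1 := line_diff_integrable s a1.
have phiE x : 'i%C * (line_diff a s x - line_diff (a + 1) s x) = pi_ x + ni_ x.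
  rewrite /pi_ /ni_ !strip_kernel_ends // /line_diff; ring.
have iphi : cintegrable `[0, +oo[ (fun x => pi_ x + ni_ x).
  apply: (@eq_cintegrable _ _ _ (fun x => 'i%C * (line_diff a s x - line_diff (a + 1) s x))) => //.
  by apply: cintegrableZ => //; exact: cintegrableB.
have lim1 := cintegral_exhaust iphi.
have ab n : 0 < (n.+1%:R^-1 : R) < n.+2%:R.
  rewrite invr_gt0 ltr0n /=; apply: (@le_lt_trans _ _ 1); last by rewrite ltr1n.
  by rewrite invf_le1 ?ler1n ?ltr0n.
have lim2 : ccvg (fun n => cintegral `[n.+1%:R^-1, n.+2%:R] (fun x => pi_ x + ni_ x))
    (0 + 0 + (-1) * cintegral `[0, 1] (fun y => cpow (a + y%:C) (- s) - cpow (a + 2^-1) (- s))).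
  apply: ccvg_eq (ccvgD (ccvgD (kernel_mean_cvgy a0 i0 i1 s) (kernel_mean_cvgy a0 ni0 ni1 s))
     (ccvgZ (-1) (kernel_mean_cvg0 s a0))) => n.
  have [n0 n1] := andP (ab n).
  have [j1 e1] := strip_kernel_integral a0 i0 i1 s n0 n1.
  have [j2 e2] := strip_kernel_integral a0 ni0 ni1 s n0 n1.
  by rewrite cintegralD // e1 e2; ring.
have := ccvg_unique lim1 lim2.
have [i01 e01] := pow_integral a0 s1.
have m01 : measurable (`[0, 1]%classic : set R) by [].
have ic : cintegrable `[0, 1] (fun _ : R => cpow (a + 2^-1) (- s)).
  by apply: segment_integrable => y _; exists 0; exact: cderiv_cst.
have ec : cintegral `[0, 1] (fun _ : R => cpow (a + 2^-1) (- s)) = cpow (a + 2^-1) (- s).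
  have [_ ->] := @cFTC R 0 1 (fun=> cpow (a + 2^-1) (- s)) (fun y => cpow (a + 2^-1) (- s) * y%:C) ltr01
    (fun t _ => cderiv_eq (cderivZ _ (cderiv_real t)) (mulr1 _)) (fun t _ => ex_intro _ 0 (cderiv_cst _ t)).
  by rewrite -[(1 : R)%:C]/(1 : R[i]) -[(0 : R)%:C]/(0 : R[i]) mulr1 mulr0 subr0.
rewrite cintegralB // e01 ec.
rewrite -(@eq_cintegral _ _ (fun x => 'i%C * (line_diff a s x - line_diff (a + 1) s x))) //.
rewrite cintegralZ //; last exact: cintegrableB.
rewrite cintegralB // /hurwitz_rep.
set A := cintegral _ (line_diff a s); set B := cintegral _ (line_diff (a + 1) s) => e.
have {}e : 'i%C * (A - B) = 0 + 0 + -1 * ((cpow a (1 - s) - cpow (a + 1) (1 - s)) / (s - 1) -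
  cpow (a + 2^-1) (- s)) by exact: e.
have -> : cpow a (1 - s) / (s - 1) + 'i%C * A - (cpow (a + 1) (1 - s) / (s - 1) + 'i%C * B) =
  (cpow a (1 - s) - cpow (a + 1) (1 - s)) / (s - 1) + 'i%C * (A - B) by ring.
by rewrite e; ring.
Qed.

End DifferenceEquation.

(** * Summation, and the part regular at 1 *)

Section Sum.
Variable R : realType.
Local Notation mu := (@lebesgue_measure R).
Implicit Types (a s c z : R[i]) (x y : R).

Lemma ln_power_cvg0 (p q : R) : 0 < p -> 0 < q ->
  (fun n => expR (- q * ln (p + n%:R))) @ \oo --> (0 : R).
Proof.
move=> p0 q0; apply/cvgrPdist_lt => e e0.
exists (Num.trunc (expR (- ln e / q))).+1 => // n /= hn.
have pn : 0 < p + n%:R by rewrite ltr_pwDl.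
rewrite sub0r normrN ger0_norm ?expR_ge0 // -[ltRHS]lnK ?posrE // ltr_expR.
have : - ln e / q < ln (p + n%:R).
  rewrite -[ltLHS]expRK ltr_ln ?posrE ?expR_gt0 //.
  apply: lt_le_trans (truncnS_gt _) _.
  by apply: (@le_trans _ _ n%:R); [rewrite ler_nat | rewrite lerDr ltW].
by rewrite ltr_pdivrMr // mulNr ltrNl mulrC.
Qed.

Lemma cmod_cpow_le c z (r : R) : Re c <= 0 -> 0 < r -> r <= cmodulus z ->
  cmodulus (cpow z c) <= expR (`|Im c| * pi) * expR (Re c * ln r).
Proof.
move=> c0 r0 rz; have m0 : 0 < cmodulus z by apply: lt_le_trans r0 rz.
have zN0 : z != 0 by rewrite -cmod_gt0.
rewrite /cpow cmod_cexp ReM Re_clog Im_clog -expRD ler_expR addrC; apply: lerD.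
  apply: le_trans (ler_norm _) _; rewrite normrN normrM ler_wpM2l //.
  by rewrite ler_norml; exact: carg_pi.
by rewrite ler_wnM2l // ler_ln ?posrE.
Qed.

(** On the lines in question |z| >= Re a + n, so the powers are bounded by
(Re a + n)^(1 - Re s) and (Re a + n)^(- Re s) up to constants; the bounded argument
only affects the constants. *)
Lemma hurwitz_rep_cvg0 a s : 0 < Re a -> 1 < Re s ->
  ccvg (fun n => hurwitz_rep (a + n%:R) s) 0.
Proof.
move=> a0 s1; pose w := \int[mu]_(x in `[0, +oo[) fermi x.
pose c1 := expR (`|Im (1 - s)| * pi) / cmodulus (s - 1).
pose c2 := 4 * (expR (`|Im (- s)| * pi) * w).
have m0y : measurable (`[0, +oo[%classic : set R) by [].
apply: ccvg0P; exists (fun n => c1 * expR (- (Re s - 1) * ln (Re a + n%:R)) +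
   c2 * expR (- Re s * ln (Re a + n%:R))); last first.
  have q1 : 0 < Re s - 1 by rewrite subr_gt0.
  have q2 : 0 < Re s by lra.
  suff: (fun n => c1 * expR (- (Re s - 1) * ln (Re a + n%:R)) +
      c2 * expR (- Re s * ln (Re a + n%:R))) @ \oo --> c1 * 0 + c2 * 0.
    by rewrite !mulr0 addr0.
  apply: cvgD; apply: cvgM; [exact: cvg_cst | | exact: cvg_cst | ]; exact: ln_power_cvg0.
move=> n; have rn : 0 < Re a + n%:R by rewrite ltr_pwDl.
have Rn : Re (a + n%:R) = Re a + n%:R by rewrite ReD Re_nat.
have an0 : 0 < Re (a + n%:R) by rewrite Rn.
have le_mod z : Re z = Re a + n%:R -> Re a + n%:R <= cmodulus z.
  by move=> <-; apply: le_trans (ler_norm _) (Re_le_cmod _).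
apply: le_trans (cmodD _ _) _; apply: lerD.
  rewrite cmodM cmodV /c1 mulrAC ler_wpM2r ?invr_ge0 ?cmod_ge0 //.
  have -> : - (Re s - 1) = Re (1 - s) by rewrite ReD ReN Re1; ring.
  by apply: cmod_cpow_le; rewrite ?le_mod // ReD ReN Re1; lra.
rewrite cmodM cmodi mul1r.
pose B : R := 2 * (expR (`|Im (- s)| * pi) * expR (- Re s * ln (Re a + n%:R))).
have hb x : `[0, +oo[%classic x -> cmodulus (line_diff (a + n%:R) s x) <= B * fermi x.
  move=> _; rewrite cmodM cmodR (ger0_norm (ltW (fermi_gt0 _))).
  rewrite ler_wpM2r ?(ltW (fermi_gt0 _)) //; apply: le_trans (cmodBD _ _) _.
  rewrite /B mulr_natl mulr2n -ReN.
  have s0 : Re (- s) <= 0 by rewrite ReN; lra.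
  by apply: lerD; apply: cmod_cpow_le; rewrite ?le_mod ?Re_line ?Re_Ni.
have iB : mu.-integrable `[0, +oo[ (EFin \o (fun x => B * fermi x)).
  by apply: integrableZ => //; exact: integrable_fermi.
apply: le_trans (cmod_cintegral m0y (line_diff_integrable s an0) iB hb) _.
rewrite RintegralZl //; last exact: integrable_fermi.
by rewrite /B /c2 -/w le_eqVlt; apply/orP; left; apply/eqP; ring.
Qed.

Lemma hurwitz_partial_sum a s n : 0 < Re a -> s != 1 ->
  \sum_(k < n) cpow (k%:R + (a + 2^-1)) (- s) = hurwitz_rep a s - hurwitz_rep (a + n%:R) s.
Proof.
move=> a0 s1; elim: n => [|n IH]; first by rewrite big_ord0 addr0 subrr.
rewrite big_ord_recr /= IH.
have an0 : 0 < Re (a + n%:R) by rewrite ReD Re_nat ltr_pwDl.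
have -> : n%:R + (a + 2^-1) = (a + n%:R) + 2^-1 by ring.
rewrite -(hurwitz_step an0 s1) -addn1 natrD [a + (_ + _)]addrA.
have e (X Y Z : R[i]) : X - Y + (Y - Z) = X - Z by rewrite addrA subrK.
exact: e.
Qed.

Lemma hurwitz_series a s : 0 < Re a -> 1 < Re s ->
  cseries_to (fun k => cpow (k%:R + (a + 2^-1)) (- s)) (hurwitz_rep a s).
Proof.
move=> a0 s1; apply/cseries_toP.
have sN1 : s != 1 by apply: contraTneq s1 => ->; rewrite Re1 ltxx.
apply: (@ccvg_eq _ (fun n => hurwitz_rep a s + (-1) * hurwitz_rep (a + n%:R) s)).
  by move=> n; rewrite hurwitz_partial_sum // mulN1r.
rewrite -[X in ccvg _ X]addr0 -[0](mulr0 (-1 : R[i])).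
by apply: ccvgD; [exact: ccvg_cst | apply: ccvgZ; exact: hurwitz_rep_cvg0].
Qed.

End Sum.

Section RegularPart.
Variable R : realType.
Implicit Types (a s c z u : R[i]) (x y : R).

(** The moments of order k, tilted by exp (u L), of the two logarithms L involved:
log (a + j x) against the weight, and t log a on [0, 1]. *)
Definition line_moment a (j : R[i]) (k : nat) u := cintegral `[0, +oo[
  (fun x => clog (a + j * x%:C) ^+ k * cexp (u * clog (a + j * x%:C)) * (fermi x)%:C).
Definition segment_moment a (k : nat) u := cintegral `[0, 1]
  (fun x : R => (x%:C * clog a) ^+ k * cexp (u * (x%:C * clog a)) * 1).

Variable a : R[i].
Hypothesis a0 : 0 < Re a.

Lemma segment_dominated : exp_dominated `[0, 1] (fun x : R => x%:C * clog a) (fun _ => 1).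
Proof.
split => [//|x _|x _|r].
- by eexists; exact: (cderivM (cderiv_real x) (cderiv_cst (clog a) x)).
- by exists 0; exact: cderiv_cst.
exists (fun _ => expR (`|r| * cmodulus (clog a))).
  exact: segment_cst_integrable.
move=> x; rewrite /= in_itv /= => /andP[x0 x1].
rewrite cmod1 mulr1 ler_expR cmodM cmodR; apply: le_trans (ler_norm _) _.
rewrite normrM ler_wpM2l // !normrM normr_id !ger0_norm ?cmod_ge0 //.
by rewrite ler_piMl ?cmod_ge0.
Qed.

(** The function left when 1 / (s - 1) is removed.  The quotient (a^(1 - s) - 1) / (s - 1)
is written -log a times the integral of a^((1 - s) t) over 0 <= t <= 1, which makes
it an integral of exponentials too, with no singularity at 1. *)
Definition regular_part s : R[i] :=
  - clog a * segment_moment a 0 (1 - s) + 'i%C * (line_moment a (- 'i%C) 0 (- s) - line_moment a 'i%C 0 (- s)).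

Definition regular_coef s0 (k : nat) : R[i] :=
  (-1) ^+ k / k`!%:R *
  (- clog a * segment_moment a k (1 - s0) + 'i%C * (line_moment a (- 'i%C) k (- s0) - line_moment a 'i%C k (- s0))).

Lemma regular_pseries s0 s : pseries_to (regular_coef s0) (s - s0) (regular_part s).
Proof.
have i0 : Re ('i%C : R[i]) = 0 by [].
have h0 := exp_integral_series segment_dominated (1 - s0) (1 - s).
have h1 := exp_integral_series (line_dominated a0 i0 (@cmodi R)) (- s0) (- s).
have h2 := exp_integral_series (line_dominated a0 (@Re_Ni R) (@cmod_Ni R)) (- s0) (- s).
have e D (L h : R -> R[i]) u : cintegral D (fun x => cexp (u * L x) * h x) =
    cintegral D (fun x => L x ^+ 0 * cexp (u * L x) * h x).
  by apply: eq_cintegral => x _; rewrite expr0 mul1r.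
move: h0 h1 h2; rewrite !e => h0 h1 h2.
have := ccvgD (ccvgZ (- clog a) h0) (ccvgZ 'i%C (ccvgD h2 (ccvgZ (-1) h1))).
rewrite !mulN1r -/(regular_part s); apply: ccvg_eq => n.
have -> : 1 - s - (1 - s0) = - (s - s0) by ring.
have -> : - s - - s0 = - (s - s0) by ring.
rewrite (mulr_sumr _ _ _ (-1)) -big_split /= !mulr_sumr -big_split /=.
apply: eq_bigr => k _; rewrite /regular_coef (exprNn (s - s0)).
rewrite -/(segment_moment a k (1 - s0)) -/(line_moment a 'i%C k (- s0)) -/(line_moment a (- 'i%C) k (- s0)).
have E (L X Y Z p q w : R[i]) : - L * (X / q * (p * w)) +
   'i%C * (Y / q * (p * w) + -1 * (Z / q * (p * w))) = p / q * (- L * X + 'i%C * (Y - Z)) * w.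
  by ring.
exact: E.
Qed.

End RegularPart.

(** * The zeta function and the Stieltjes constants *)

Section Assembly.
Variable R : realType.
Implicit Types (a s c z u v : R[i]) (x y : R).

(** The primitive is not divided by log a, which is 0 for a = 1. *)
Lemma segment_moment0 a s : s != 1 -> - clog a * segment_moment a 0 (1 - s) = (cpow a (1 - s) - 1) / (s - 1).
Proof.
move=> s1; have s10 : s - 1 != 0 by rewrite subr_eq0.
have m01 : measurable (`[0, 1]%classic : set R) by [].
have fd t : cderiv (fun t : R => cexp ((1 - s) * (t%:C * clog a))) t
    ((1 - s) * clog a * cexp ((1 - s) * (t%:C * clog a))).
  apply: cderiv_eq (cderiv_exp (cderivZ (1 - s) (cderivM (cderiv_real t) (cderiv_cst (clog a) t)))) _.
  by rewrite mul1r mulr0 addr0.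
have [i1 e1] := @cFTC R 0 1 _ _ ltr01 (fun t _ => fd t)
  (fun t _ => ex_intro _ _ (cderivZ ((1 - s) * clog a) (fd t))).
have i0 := exp_moment_integrable (segment_dominated a) (1 - s) 0.
have := e1; rewrite -[(1 : R)%:C]/(1 : R[i]) -[(0 : R)%:C]/(0 : R[i]) mul1r mul0r mulr0 cexp0 => {}e1.
rewrite [cpow _ _]/cpow -e1 (@eq_cintegral _ _ _ (fun x => (1 - s) * clog a *
  ((x%:C * clog a) ^+ 0 * cexp ((1 - s) * (x%:C * clog a)) * 1))).
  by rewrite cintegralZ // -/(segment_moment a 0 (1 - s)); field.
by move=> x _; rewrite expr0 mul1r mulr1.
Qed.

Lemma segment_moment_at0 a k : segment_moment a k 0 = clog a ^+ k / k.+1%:R.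
Proof.
have k0 : k.+1%:R != 0 :> R[i] by rewrite pnatr_eq0.
have fd (t : R) : cderiv (fun x : R => clog a ^+ k / k.+1%:R * x%:C ^+ k.+1) t
    (clog a ^+ k * t%:C ^+ k).
  apply: cderiv_eq (cderivZ (clog a ^+ k / k.+1%:R) (cderivX k.+1 (cderiv_real t))) _.
  by rewrite mulr1 /=; field.
have [_] := @cFTC R 0 1 _ _ ltr01 (fun t _ => fd t)
  (fun t _ => ex_intro _ _ (cderivZ (clog a ^+ k) (cderivX k (cderiv_real t)))).
rewrite -[(1 : R)%:C]/(1 : R[i]) -[(0 : R)%:C]/(0 : R[i]) expr1n expr0n /= mulr0 subr0 mulr1 => <-.
apply: eq_cintegral => x _; rewrite mul0r cexp0 !mulr1 exprMn mulrC //.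
Qed.

Lemma line_moment0 a j s : line_moment a j 0 (- s) =
  cintegral `[0, +oo[ (fun x => cpow (a + j * x%:C) (- s) * (fermi x)%:C).
Proof. by apply: eq_cintegral => x _; rewrite expr0 mul1r. Qed.

Lemma line_diff_moments a s : 0 < Re a ->
  cintegral `[0, +oo[ (line_diff a s) = line_moment a (- 'i%C) 0 (- s) - line_moment a 'i%C 0 (- s).
Proof.
move=> a0; have i0 : Re ('i%C : R[i]) = 0 by [].
rewrite !line_moment0 -cintegralB //.
- by apply: eq_cintegral => x _; rewrite /line_diff mulrBl.
- exact: line_pow_integrable a0 (@Re_Ni R) (@cmod_Ni R) _.
- exact: line_pow_integrable a0 i0 (@cmodi R) _.
Qed.

Lemma hurwitz_rep_regular a s : 0 < Re a -> s != 1 ->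
  hurwitz_rep a s = 1 / (s - 1) + regular_part a s.
Proof.
move=> a0 s1; rewrite /regular_part segment_moment0 // -line_diff_moments // /hurwitz_rep.
by rewrite mulrBl; ring.
Qed.

Lemma inv_pseries s0 s : cmodulus (s - s0) < cmodulus (s0 - 1) ->
  pseries_to (fun k => (-1) ^+ k / (s0 - 1) ^+ k.+1) (s - s0) (1 / (s - 1)).
Proof.
move=> h; set d := s0 - 1 in h *; set q := s - s0 in h *.
have d1 : 0 < cmodulus d by apply: le_lt_trans (cmod_ge0 _) h.
have d0 : d != 0 by rewrite -cmod_gt0.
have -> : s - 1 = d + q by rewrite /d /q; ring.
have dq : d + q != 0.
  apply: contraTneq h => /eqP; rewrite addr_eq0 => /eqP ->.
  by rewrite cmodN ltxx.
apply: (@ccvg_eq _ (fun n => 1 / (d + q) + (- (d + q)^-1) * (- (q / d)) ^+ n)).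
  move=> n; elim: n => [|n IH]; first by rewrite big_ord0 expr0; field.
  rewrite big_ord_recr /= -IH [in LHS]exprS.
  have -> : (-1) ^+ n / d ^+ n.+1 * q ^+ n = (- (q / d)) ^+ n / d.
    by rewrite (exprNn (q / d)) exprMn exprVn exprS invfM; ring.
  by move: ((- (q / d)) ^+ n) => Q; field; rewrite dq d0.
rewrite -[X in ccvg _ X]addr0 -[0](mulr0 (- (d + q)^-1)).
apply: ccvgD; first exact: ccvg_cst.
apply: ccvgZ; apply: ccvg0P; exists (fun n => (cmodulus q / cmodulus d) ^+ n).
  by move=> n; rewrite cmodX cmodN cmodM cmodV.
apply: cvg_expr; rewrite ger0_norm ?divr_ge0 ?cmod_ge0 //.
by rewrite ltr_pdivrMr // mul1r.
Qed.

(** Near s0 the pole has a geometric expansion, and the regular part has one everywhere. *)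
Lemma hurwitz_rep_analytic a s0 : 0 < Re a -> s0 != 1 -> analytic_at (hurwitz_rep a) s0.
Proof.
move=> a0 s01; apply/analytic_atP; exists (cmodulus (s0 - 1)).
  by rewrite cmod_gt0 subr_eq0.
exists (fun k => (-1) ^+ k / (s0 - 1) ^+ k.+1 + regular_coef a s0 k) => s hs.
rewrite hurwitz_rep_regular //; last first.
  by apply: contraTneq hs => ->; rewrite cmodB ltxx.
apply: ccvg_eq (ccvgD (inv_pseries hs) (regular_pseries a0 s0 s)) => n.
by rewrite -big_split /=; apply: eq_bigr => k _; rewrite mulrDl.
Qed.

(** Two analytic continuations of the same series agree off 1, so the choice made in the
definition of the zeta function does not matter. *)
Lemma hurwitz_zetaE v s : 2^-1 < Re v -> s != 1 ->
  hurwitz_zeta s v = hurwitz_rep (v - 2^-1) s.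
Proof.
move=> hv s1; have a0 : 0 < Re (v - 2^-1) by rewrite -halfC ReD ReN ReC subr_gt0.
have va : v - 2^-1 + 2^-1 = v by rewrite subrK.
have hZ : is_hurwitz_zeta v (hurwitz_rep (v - 2^-1)).
  split; last by move=> t; exact: hurwitz_rep_analytic.
  by move=> t t1; have := hurwitz_series a0 t1; rewrite va.
rewrite /hurwitz_zeta; case: xgetP => [Z _ [Z1 Z2] | /(_ _ hZ) //].
apply: (identity_off_one Z2 (fun t => hurwitz_rep_analytic a0)) => // t t1.
by apply: ccvg_unique ((cseries_toP _ _).1 (Z1 t t1)) ((cseries_toP _ _).1 (hZ.1 t t1)).
Qed.

Definition stieltjes_rep a (n : nat) : R[i] :=
  - (clog a ^+ n.+1 / n.+1%:R) + 'i%C * (line_moment a (- 'i%C) n (- 1) - line_moment a 'i%C n (- 1)).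

Lemma regular_coef1 a k : regular_coef a 1 k = (-1) ^+ k / k`!%:R * stieltjes_rep a k.
Proof.
rewrite /regular_coef /stieltjes_rep subrr segment_moment_at0; congr (_ * (_ + _)).
by rewrite mulNr mulrA -exprS.
Qed.

(** Both families of constants give the expansion at 1 of the same function. *)
Lemma stieltjesE v n : 2^-1 < Re v -> stieltjes n v = stieltjes_rep (v - 2^-1) n.
Proof.
move=> hv; have a0 : 0 < Re (v - 2^-1) by rewrite -halfC ReD ReN ReC subr_gt0.
pose r s := hurwitz_zeta s v - 1 / (s - 1).
have rE s : s != 1 -> r s = regular_part (v - 2^-1) s.
  by move=> s1; rewrite /r hurwitz_zetaE // hurwitz_rep_regular // addrAC subrr add0r.
have hg : is_stieltjes v (stieltjes_rep (v - 2^-1)).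
  move=> s s1; apply/cseries_toP; rewrite -/(r s) rE //.
  apply: ccvg_eq (regular_pseries a0 1 s) => N.
  by apply: eq_bigr => k _; rewrite regular_coef1.
rewrite /stieltjes; case: xgetP => [g _ hg'|/(_ _ hg) //].
pose co (g : nat -> R[i]) k := (-1) ^+ k / k`!%:R * g k.
have ps g0 : is_stieltjes v g0 -> forall z, 0 < cmodulus z < 1 -> pseries_to (co g0) z (r (z + 1)).
  move=> h z /andP[z0 _]; have z1 : z + 1 != 1 by rewrite -subr_eq0 addrK -cmod_gt0.
  apply: ccvg_eq ((cseries_toP _ _).1 (h _ z1)) => N.
  by apply: eq_bigr => k _; rewrite /co addrK.
have := @pseries_unique R (co g) (co (stieltjes_rep (v - 2^-1))) (fun z => r (z + 1)) 1 ltr01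
  (ps _ hg') (ps _ hg) n.
by apply: mulfI; rewrite mulf_neq0 ?invr_eq0 ?fact_neq0 // signr_eq0.
Qed.

End Assembly.

(** * The form with sine and arctangent, and the theorem *)

Section SineForm.
Variable R : realType.
Implicit Types (a s v : R[i]) (x : R).

Lemma i_neq0 : 'i%C != 0 :> R[i].
Proof. by rewrite -cmod_gt0 cmodi. Qed.

Lemma two_neq0 : 2 != 0 :> R[i].
Proof. by rewrite pnatr_eq0. Qed.

(** With P = log (a + i x) and M = log (a - i x), the arctangent is (P - M) / (2 i) and
the denominator is exp (s (P + M) / 2).  So the two exponentials of the sine become
exp (-s M) and exp (-s P). *)
Lemma sine_form v s x : 2^-1 < Re v ->
  csin (s * carctan (2 * x%:C / (2 * v - 1))) / cpow (v ^+ 2 - v + 4^-1 + x%:C ^+ 2) (s / 2)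
  = (2 * 'i%C)^-1 *
    (cpow (v - 2^-1 + - 'i%C * x%:C) (- s) - cpow (v - 2^-1 + 'i%C * x%:C) (- s)).
Proof.
move=> hv; have a0 : 0 < Re (v - 2^-1) by rewrite -halfC ReD ReN ReC subr_gt0.
set a := v - 2^-1 in a0 *; have aN0 := Re_gt0_neq0 a0.
have i0 : Re ('i%C : R[i]) = 0 by [].
have ii := @sqr_unit_imag R 'i%C i0 (@cmodi R).
have p0 : 0 < Re (a + 'i%C * x%:C) by rewrite Re_line.
have m0 : 0 < Re (a + - 'i%C * x%:C) by rewrite Re_line ?Re_Ni.
have va : 2 * v - 1 = 2 * a by rewrite /a; field.
have e2 : 4 = 2 * 2 :> R[i] by rewrite -natrM.
have zE : 2 * x%:C / (2 * v - 1) = x%:C / a by rewrite va; field.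
have qE : v ^+ 2 - v + 4^-1 + x%:C ^+ 2 = (a + 'i%C * x%:C) * (a + - 'i%C * x%:C).
  have -> : (a + 'i%C * x%:C) * (a + - 'i%C * x%:C) = a ^+ 2 - ('i%C * 'i%C) * x%:C ^+ 2 by ring.
  by rewrite ii /a; field.
have e3 : 1 + 'i%C * (x%:C / a) = (a + 'i%C * x%:C) / a by field.
have e4 : 1 - 'i%C * (x%:C / a) = (a + - 'i%C * x%:C) / a by field.
rewrite zE qE /carctan e3 e4 !clog_div // /cpow clogM // /csin.
move: (clog (a + 'i%C * x%:C)) (clog (a + - 'i%C * x%:C)) (clog a) => P M L.
have iN := i_neq0; have t0 := two_neq0.
have -> : 'i%C * (s * ((P - L - (M - L)) / (2 * 'i%C))) = s / 2 * (P - M) by field; rewrite iN.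
rewrite mulrAC -cexpN mulrBl -!cexpD [RHS]mulrC.
have -> : s / 2 * (P - M) + - (s / 2 * (P + M)) = - s * M by field.
by have -> : - (s / 2 * (P - M)) + - (s / 2 * (P + M)) = - s * P by field.
Qed.

End SineForm.

Theorem corollary1 (R : realType) (v : R[i]) (hv : 2^-1 < complex.Re v) :
  (forall s : R[i], s != 1 ->
     let f (x : R) : R[i] :=
       (cpow (v - 2^-1 - 'i%C * x%:C) (- s) - cpow (v - 2^-1 + 'i%C * x%:C) (- s))
         / (expR (2 * pi * x) + 1)%:C in
     cintegrable `[0, +oo[ f /\
     hurwitz_zeta s v =
       cpow (v - 2^-1) (1 - s) / (s - 1) + 'i%C * cintegral `[0, +oo[ f) /\
  (forall s : R[i], s != 1 ->
     let f (x : R) : R[i] :=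
       csin (s * carctan (2 * x%:C / (2 * v - 1)))
         / cpow (v ^+ 2 - v + 4^-1 + x%:C ^+ 2) (s / 2)
         * (1 / (expR (2 * pi * x) + 1)%:C) in
     cintegrable `[0, +oo[ f /\
     hurwitz_zeta s v =
       cpow (v - 2^-1) (1 - s) / (s - 1) - 2 * cintegral `[0, +oo[ f) /\
  (forall n : nat,
     let f (x : R) : R[i] :=
       (clog (v - 2^-1 - 'i%C * x%:C) ^+ n / (v - 2^-1 - 'i%C * x%:C)
        - clog (v - 2^-1 + 'i%C * x%:C) ^+ n / (v - 2^-1 + 'i%C * x%:C))
         * (1 / (expR (2 * pi * x) + 1)%:C) in
     cintegrable `[0, +oo[ f /\
     stieltjes n v =
       - (clog (v - 2^-1) ^+ n.+1 / n.+1%:R) + 'i%C * cintegral `[0, +oo[ f).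
Proof.
have a0 : 0 < Re (v - 2^-1) by rewrite -halfC ReD ReN ReC subr_gt0.
have i0 : Re ('i%C : R[i]) = 0 by [].
have fE x : (fermi x)%:C = 1 / (expR (2 * pi * x) + 1)%:C :> R[i].
  by rewrite div1r -fmorphV.
have iN := @i_neq0 R; have t0 := @two_neq0 R.
have my : measurable (`[0, +oo[%classic : set R) by [].
have main s : cintegrable `[0, +oo[ (line_diff (v - 2^-1) s) by exact: line_diff_integrable.
split; [|split].
- move=> s s1 f.
  have e x : line_diff (v - 2^-1) s x = f x.
    by rewrite /line_diff /f fE div1r mulNr.
  split; first exact: eq_cintegrable (main s).
  by rewrite hurwitz_zetaE // /hurwitz_rep; congr (_ + _ * _); exact: eq_cintegral.
- move=> s s1 f.
  have e x : (2 * 'i%C)^-1 * line_diff (v - 2^-1) s x = f x.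
    by rewrite /f sine_form // -fE mulrA.
  have i1 : cintegrable `[0, +oo[ (fun x => (2 * 'i%C)^-1 * line_diff (v - 2^-1) s x).
    exact: cintegrableZ.
  split; first exact: eq_cintegrable i1.
  rewrite hurwitz_zetaE // /hurwitz_rep; congr (_ + _).
  have -> : cintegral `[0, +oo[ f = (2 * 'i%C)^-1 * cintegral `[0, +oo[ (line_diff (v - 2^-1) s).
    by rewrite -cintegralZ //; apply: eq_cintegral => x _; rewrite e.
  have ii := @sqr_unit_imag R 'i%C i0 (@cmodi R).
  suff E (A : R[i]) : 'i%C * A = - (2 * ((2 * 'i%C)^-1 * A)) by exact: E.
  have -> : 2 * ((2 * 'i%C)^-1 * A) = 'i%C^-1 * A by field.
  by rewrite -mulNr; congr (_ * _); apply: (mulfI iN); rewrite mulrN divff // ii opprK.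
- move=> n f.
  pose m (j : R[i]) x := clog (v - 2^-1 + j * x%:C) ^+ n *
    cexp (- 1 * clog (v - 2^-1 + j * x%:C)) * (fermi x)%:C.
  have im (j : R[i]) : Re j = 0 -> cmodulus j = 1 -> cintegrable `[0, +oo[ (m j).
    by move=> j0 j1; exact: (exp_moment_integrable (line_dominated a0 j0 j1)).
  have ip := im _ i0 (@cmodi R); have imn := im _ (@Re_Ni R) (@cmod_Ni R).
  have mE (j : R[i]) x : Re j = 0 -> m j x =
      clog (v - 2^-1 + j * x%:C) ^+ n / (v - 2^-1 + j * x%:C) * (fermi x)%:C.
    move=> j0; rewrite /m mulN1r cexpN cexp_clog //.
    by apply: Re_gt0_neq0; rewrite Re_line.
  have e x : m (- 'i%C) x - m 'i%C x = f x.
    by rewrite !mE ?Re_Ni // -mulrBl fE /f mulNr.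
  split; first by apply: eq_cintegrable (cintegrableB my imn ip).
  rewrite stieltjesE // /stieltjes_rep; congr (_ + _ * _).
  have -> : cintegral `[0, +oo[ f = cintegral `[0, +oo[ (fun x => m (- 'i%C) x - m 'i%C x).
    by apply: eq_cintegral => x _; rewrite e.
  by rewrite cintegralB.
Qed.
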